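(* For every $\varepsilon>0$ there exists $\Delta_0$ such that for every integer $\Delta\ge\Delta_0$ the following holds with $\delta=(192\log\Delta)^{2/\varepsilon}$. Let $G$ be a triangle-free graph of maximum degree $\Delta$ and let $\mathscr{H}=(L,H)$ be a cover of $G$ such that \[ |L(u)|\ \ge\ (1+\varepsilon)\max\left\{\frac{\deg(u)}{\log\deg(u)},\ \frac{\delta}{\log\delta}\right\} \] for all $u\in V(G)$. Then $G$ is $\mathscr{H}$-colourable.
   Context: Graphs are finite and simple; $\log$ is the natural logarithm; $\deg(u)$ is the degree of $u$ in $G$. A cover of a graph $G$ is a pair $\mathscr{H}=(L,H)$ consisting of a graph $H$ and a function $L:V(G)\to 2^{V(H)}$ such that: (1) the sets $\{L(u):u\in V(G)\}$ form a partition of $V(H)$; (2) for every $u\in V(G)$ the graph $H[L(u)]$ is complete; (3) if $E_H(L(u),L(v))\neq\varnothing$ (i.e. $H$ has an edge between $L(u)$ and $L(v)$) then either $u=v$ or $uv\in E(G)$; (4) if $uv\in E(G)$ then $E_H(L(u),L(v))$ is a (possibly empty) matching. An $\mathscr{H}$-colouring of $G$ is an independent set in $H$ of size $|V(G)|$; $G$ is $\mathscr{H}$-colourable if it has an $\mathscr{H}$-colouring. For vertices with $\deg(u)\le 1$, where $\deg(u)/\log\deg(u)$ is undefined, the maximum is understood to be $\delta/\log\delta$. *)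

(* Defs.v *)
From HB Require Import structures.
From mathcomp Require Import all_boot all_order all_algebra.
From mathcomp Require Import reals exp.

Set Implicit Arguments.
Unset Strict Implicit.
Unset Printing Implicit Defensive.

Import Order.TTheory GRing.Theory Num.Theory.

Record sgraph := SGraph {
  vertex :> finType;
  edge : rel vertex;
  edge_sym : symmetric edge;
  edge_irrefl : irreflexive edge }.

Definition neighbours (G : sgraph) (u : G) : {set G} := [set v | edge u v].

Definition deg (G : sgraph) (u : G) : nat := #|neighbours u|.

Definition max_degree (G : sgraph) : nat := \max_(u : G) deg u.

Definition triangle_free (G : sgraph) : Prop :=
  forall x y z : G, ~~ [&& edge x y, edge y z & edge x z].

Definition independent (G : sgraph) (I : {set G}) : Prop :=
  {in I &, forall x y : G, ~~ edge x y}.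

Definition clique (G : sgraph) (A : {set G}) : Prop :=
  {in A &, forall x y : G, x != y -> edge x y}.

(* An undirected edge is represented by the set of its two endpoints. *)
Definition edges_between (G : sgraph) (A B : {set G}) : {set {set G}} :=
  [set [set x; y] | x in A, y in B & edge x y].

Definition is_matching (G : sgraph) (M : {set {set G}}) : Prop :=
  {in M &, forall e f : {set G}, e != f -> [disjoint e & f]}.

(* The partition condition is on the indexed family [cover_list]: distinct
   vertices have disjoint lists.  Stating it for the set of sets
   [set cover_list u | u : G] would allow two vertices to share a list.
   Empty lists are not excluded. *)
Record graph_cover (G : sgraph) := GraphCover {
  cover_graph : sgraph;
  cover_list : G -> {set cover_graph};
  cover_disjoint : forall u v : G,
    u != v -> [disjoint cover_list u & cover_list v];
  cover_full : \bigcup_(u : G) cover_list u = [set: cover_graph];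
  cover_clique : forall u : G, clique (cover_list u);
  cover_edge : forall u v : G,
    edges_between (cover_list u) (cover_list v) != set0 ->
    u = v \/ edge u v;
  cover_matching : forall u v : G, edge u v ->
    is_matching (edges_between (cover_list u) (cover_list v)) }.

Definition is_colouring (G : sgraph) (H : graph_cover G)
    (I : {set cover_graph H}) : Prop :=
  independent I /\ #|I| = #|G|.

Definition colourable (G : sgraph) (H : graph_cover G) : Prop :=
  exists I : {set cover_graph H}, is_colouring I.

Local Open Scope ring_scope.

(* max {d / log d, delta / log delta}, read as delta / log delta when d <= 1,
   where d / log d is undefined. *)
Definition max_ratio (R : realType) (d : nat) (delta : R) : R :=
  if (d <= 1)%N then delta / ln delta
  else Num.max (d%:R / ln d%:R) (delta / ln delta).

(* Main.v *)
Require Import Defs.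
From mathcomp Require Import all_boot all_order all_algebra.
From mathcomp Require Import reals sequences exp.
From mathcomp Require Import ring lra zify.

(* Sort the vertices by scale: v has scale i when max(deg v, delta) lies in
   [2^2^i, 2^2^(i+1)].  All vertices of near scales have polynomially related
   degrees, and there are only O(log log Delta) scales above that of delta.

   First draw uniformly at random a partial colouring that is proper for the
   conflicts between near scales.  Given the colours outside N(v), the
   neighbours of v, an independent set, pick independently and uniformly an
   available colour or none.  Each of them kills one colour of v in
   expectation at most, so v keeps a fixed power of its degree of available
   colours; and a neighbour that can kill a colour of v is as likely to do so
   as to stay uncoloured, so an available colour is in conflict with few
   uncoloured neighbours.  The failure probabilities are small compared with
   any power of the degrees involved, so the lopsided local lemma applies
   without reference to the maximum degree.  A neighbour whose scale is much
   larger than that of v has so many available colours that it hits the list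
   of v with a probability polynomially small in its own degree, so that
   boundedly many neighbours per scale do.

   Then every vertex draws a random menu of a few colours from its available
   ones.  The uncoloured vertices, and those whose colour is hit by the colour
   or the menu of a neighbour of much larger scale, are recoloured from their
   menus.  A second use of the local lemma ensures that each menu has a colour
   avoiding the menus of the recoloured neighbours of near scale and of all
   neighbours of larger scale; menus of size O(log log Delta) suffice, and
   these fit because the lists are larger than a power of log Delta.

   Working scale by scale is what allows every eps > 0: for eps >= 1 the lists
   of the vertices of small degree may be shorter than log Delta, and a local
   lemma with failure probabilities measured against Delta does not apply. *)

Set Implicit Arguments.
Unset Strict Implicit.
Unset Printing Implicit Defensive.

Import Order.TTheory GRing.Theory Num.Theory.

Local Open Scope ring_scope.

(** * The lopsided local lemma *)

Section LocalLemma.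

Variables (R : realFieldType) (F I K : finType).
Variables (Om : {set F}) (E : I -> {set F}) (p : I -> R) (P : pred I).
Variables (nb : I -> pred I) (r : I -> F -> K).

Hypothesis p_ge0 : forall i, P i -> 0 <= p i.
Hypothesis p_le : forall i, P i -> p i <= 4^-1.
Hypothesis fibre_bound : forall i k, P i ->
  #|E i :&: [set f in Om | r i f == k]|%:R <=
  p i * #|[set f in Om | r i f == k]|%:R.
Hypothesis fibre_const : forall i j, P i -> P j -> ~~ nb i j ->
  {in Om &, forall f g, r i f = r i g -> (f \in E j) = (g \in E j)}.
Hypothesis sum_le : forall i, P i -> \sum_(j | P j && nb i j) p j <= 4^-1.

Definition avoiding (S : {set I}) : {set F} :=
  [set f in Om | [forall j in S, f \notin E j]].

Lemma avoiding_sub (S T : {set I}) :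
  S \subset T -> avoiding T \subset avoiding S.
Proof.
move=> /subsetP ST; apply/subsetP => f; rewrite !inE => /andP[-> /forall_inP h].
by apply/forall_inP => j /ST /h.
Qed.

(** [r i f] is what remains of [f] when event [i] is resampled; its fibres are the conditional
    spaces. The events in [S] are constant on each fibre, so a fibre meets [avoiding S] fully or not
    at all, and the fibrewise bounds add up. *)
Lemma avoiding_far (i : I) (S : {set I}) : P i ->
  {in S, forall j, P j && ~~ nb i j} ->
  #|E i :&: avoiding S|%:R <= p i * #|avoiding S|%:R.
Proof.
move=> Pi hS.
have cardE (A : {set F}) :
    (#|A|%:R : R) = \sum_k #|[set f in A | r i f == k]|%:R.
  rewrite -natr_sum -sum1_card (partition_big (r i) predT) //=; congr (_%:R).
  by apply: eq_bigr => k _; rewrite -sum1_card; apply: eq_bigl => f; rewrite !inE.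
rewrite (cardE (_ :&: _)) (cardE (avoiding S)) mulr_sumr.
apply: ler_sum => k _.
case: (set_0Vmem [set f in avoiding S | r i f == k]) => [e0|[f0]].
  rewrite e0 cards0 mulr0.
  rewrite (_ : [set f in _ | _] = set0) ?cards0 //.
  apply/eqP; rewrite -subset0 -e0; apply/subsetP => f.
  by rewrite !inE => /andP[/andP[_ ->] ->].
rewrite !inE => /andP[/andP[Of0 /forall_inP hf0] /eqP rf0].
have -> : [set f in avoiding S | r i f == k] = [set f in Om | r i f == k].
  apply/setP => f; rewrite !inE; case Of: (f \in Om) => //=.
  case: eqP => [rf|]; last by rewrite andbF.
  rewrite andbT; apply/forall_inP => j jS; have /andP[Pj nij] := hS _ jS.
  by rewrite (fibre_const Pi Pj nij Of Of0) ?hf0 // rf0.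
apply: le_trans (fibre_bound k Pi); rewrite ler_nat subset_leq_card //.
by apply/subsetP => f; rewrite !inE => /andP[/andP[-> /andP[-> _]] ->].
Qed.

(** Induction on [S]. The events far from [i] are handled by [avoiding_far]; those in [nb i] have
    conditional probability at most [2 * p j] by induction, so together they remove at most half of
    [avoiding S2]. *)
Lemma avoiding_event (S : {set I}) : {in S, forall j, P j} ->
  forall i, P i -> #|E i :&: avoiding S|%:R <= 2 * p i * #|avoiding S|%:R.
Proof.
have [n] := ubnP #|S|; elim: n S => // n IHn S; rewrite ltnS => leSn PS i Pi.
pose S1 := [set j in S | nb i j]; pose S2 := S :\: S1.
have PS2 : {in S2, forall j, P j} by move=> j /setDP[/PS].
have far := @avoiding_far i S2 Pi.
have {}far : #|E i :&: avoiding S2|%:R <= p i * #|avoiding S2|%:R.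
  by apply: far => j; rewrite !inE => /andP[nij jS]; move: nij; rewrite jS (PS _ jS).
have sub : avoiding S \subset avoiding S2 by apply: avoiding_sub; apply: subsetDl.
have lb : #|avoiding S2|%:R <= 2 * #|avoiding S|%:R :> R.
  have [S10|[j0 j0S1]] := set_0Vmem S1.
    by rewrite /S2 S10 setD0; have := ler0n R #|avoiding S|; lra.
  have ltS2 : (#|S2| < n)%N.
    apply: leq_trans leSn; apply: proper_card; apply/properP; split.
      exact: subsetDl.
    by exists j0; [move: j0S1; rewrite inE => /andP[] | rewrite !inE negb_and negbK; move: j0S1; rewrite inE => ->].
  have cov : avoiding S2 \subset
      avoiding S :|: \bigcup_(j in S1) (E j :&: avoiding S2).
    apply/subsetP => f fS2; rewrite inE; case fS: (f \in avoiding S) => //=.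
    move: (fS2) fS; rewrite inE => /andP[Of /forall_inP h2].
    rewrite inE Of /= => /negbT; rewrite negb_forall => /existsP[j].
    rewrite negb_imply negbK => /andP[jS fE].
    apply/bigcupP; exists j; last by rewrite inE fE.
    apply/negPn/negP => jS1; move: (h2 j); rewrite fE => /(_ _)/negP; apply=> //.
    by rewrite in_setD jS1 jS.
  have /(le_trans _) : (#|avoiding S :|: \bigcup_(j in S1) (E j :&: avoiding S2)|%:R : R)
      <= #|avoiding S|%:R + \sum_(j in S1) 2 * p j * #|avoiding S2|%:R.
    have le1 : (#|avoiding S :|: \bigcup_(j in S1) (E j :&: avoiding S2)| <=
       #|avoiding S| + \sum_(j in S1) #|E j :&: avoiding S2|)%N.
      apply: leq_trans (leq_card_setU _ _) _; rewrite leq_add2l.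
      elim/big_ind2: _ => [|a b c d ab cd|//]; first by rewrite cards0.
      by apply: leq_trans (leq_card_setU _ _) _; rewrite leq_add.
    have : (#|avoiding S :|: \bigcup_(j in S1) (E j :&: avoiding S2)|%:R <=
       #|avoiding S|%:R + \sum_(j in S1) #|E j :&: avoiding S2|%:R :> R).
      by rewrite -natr_sum -natrD ler_nat.
    move=> /le_trans; apply; rewrite lerD2l; apply: ler_sum => j jS1.
    by apply: IHn => //; apply: PS; move: jS1; rewrite inE => /andP[].
  have leU : (#|avoiding S2|%:R : R) <=
     #|avoiding S :|: \bigcup_(j in S1) (E j :&: avoiding S2)|%:R.
    by rewrite ler_nat subset_leq_card.
  move=> /(_ _ leU); rewrite -mulr_suml -mulr_sumr => le2.
  have s4 : \sum_(j in S1) p j <= 4^-1.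
    apply: le_trans (sum_le Pi); rewrite [leRHS](bigID (mem S1)) /=.
    rewrite [X in _ <= X + _](eq_bigl (mem S1)).
      by rewrite lerDl sumr_ge0 // => j /andP[/andP[Pj _] _]; apply: p_ge0.
    move=> j /=; case jS1: (j \in S1); rewrite ?andbF // andbT.
    by move: jS1; rewrite inE => /andP[/PS -> ->].
  have := ler0n R #|avoiding S2|; nra.
have := p_ge0 Pi => p0.
have le3 : (#|E i :&: avoiding S|%:R : R) <= #|E i :&: avoiding S2|%:R.
  by rewrite ler_nat subset_leq_card // setIS.
apply: le_trans le3 _; apply: le_trans far _.
by rewrite -mulrA mulrCA ler_wpM2l.
Qed.

(** Adding the events one at a time, each leaves at least half of the outcomes, since [2 * p j] is
    at most 1/2. *)
Lemma local_lemma : Om != set0 ->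
  exists2 f, f \in Om & forall i, P i -> f \notin E i.
Proof.
move=> Om0.
suff h (n : nat) (S : {set I}) : (#|S| <= n)%N -> {in S, forall j, P j} ->
    (0 < #|avoiding S|)%N.
  have /card_gt0P[f] : (0 < #|avoiding [set j | P j]|)%N.
    by apply: (h _ _ (leqnn _)) => j; rewrite inE.
  rewrite inE => /andP[Of /forall_inP hf]; exists f => // i Pi.
  by apply: hf; rewrite inE.
elim: n S => [|n IHn] S.
  rewrite leqn0 cards_eq0 => /eqP -> _; rewrite (_ : avoiding _ = Om) ?card_gt0 //.
  apply/setP => f; rewrite inE; case: (f \in Om) => //=.
  by apply/forall_inP => j; rewrite inE.
have [->|[j jS]] := set_0Vmem S.
  by move=> _ _; apply: IHn; rewrite ?cards0 // => i; rewrite inE.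
rewrite (cardsD1 j) jS add1n ltnS => leS PS.
have PS' : {in S :\ j, forall i, P i} by move=> i /setD1P[_ /PS].
have pos := IHn _ leS PS'.
have le1 := avoiding_event PS' (PS _ jS).
have le2 := p_le (PS _ jS).
have /(subset_leq_card) : avoiding (S :\ j) \subset
    avoiding S :|: (E j :&: avoiding (S :\ j)).
  apply/subsetP => f fS; rewrite !inE; move: fS; rewrite inE.
  move=> /andP[Of /forall_inP h]; rewrite Of /=.
  case fE: (f \in E j); last first.
    rewrite orbF; apply/forall_inP => i iS; case: (eqVneq i j) => [->|ij].
      by rewrite fE.
    by apply: h; rewrite !inE ij.
  by apply/orP; right; apply/forall_inP => i; apply: h.
move=> /leq_trans /(_ (leq_card_setU _ _)); rewrite -(ler_nat R) natrD.
by rewrite -(ltr_nat R) in pos; rewrite -(ltr_nat R) => le3; nra.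
Qed.

End LocalLemma.

(* The event [E i] is resampled on the coordinates [W i], and membership in
   [E j] is determined by the coordinates [D j]. *)
Lemma local_lemma_ffun (R : realFieldType) (V T I : finType)
    (Om : {set {ffun V -> T}}) (P : pred I) (E : I -> {set {ffun V -> T}})
    (W D : I -> {set V}) (p : I -> R) :
  Om != set0 ->
  (forall i, P i -> 0 <= p i) ->
  (forall i, P i -> p i <= 4^-1) ->
  (forall i f, P i -> f \in Om ->
    #|[set g in E i :&: Om | [forall (v | v \notin W i), g v == f v]]|%:R <=
    p i * #|[set g in Om | [forall (v | v \notin W i), g v == f v]]|%:R) ->
  (forall j f g, P j -> f \in Om -> g \in Om -> {in D j, f =1 g} ->
    (f \in E j) = (g \in E j)) ->
  (forall i, P i ->
    \sum_(w in W i) \sum_(j | P j && (w \in D j)) p j <= 4^-1) ->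
  exists2 f, f \in Om & forall i, P i -> f \notin E i.
Proof.
move=> Om0 p0 p4 hfib hdet hsum.
pose r (i : I) (f : {ffun V -> T}) :=
  [ffun v => if v \in W i then None else Some (f v)].
pose nb i := [pred j | ~~ [disjoint W i & D j]].
have rP i f g : (r i g == r i f) = [forall (v | v \notin W i), g v == f v].
  apply/eqP/forall_inP => [/ffunP h v vW|h].
    by move: (h v); rewrite !ffunE (negbTE vW) => -[->].
  apply/ffunP => v; rewrite !ffunE; case: ifPn => // vW.
  by rewrite (eqP (h _ vW)).
apply: (@local_lemma R _ I _ Om E p P nb r) => //.
- move=> i k Pi.
  have [->|[f]] := set_0Vmem [set f in Om | r i f == k].
    by rewrite setI0 cards0 mulr0.
  rewrite inE => /andP[Of /eqP <-].
  have -> : [set g in Om | r i g == r i f] =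
      [set g in Om | [forall (v | v \notin W i), g v == f v]].
    by apply/setP => g; rewrite !inE rP.
  apply: le_trans (hfib i f Pi Of); rewrite ler_nat subset_leq_card //.
  by apply/subsetP => g; rewrite !inE => /and3P[-> -> ->].
- move=> i j Pi Pj; rewrite /= negbK => dis f g Of Og /eqP; rewrite rP => /forall_inP h.
  apply: hdet => // v vD; apply/eqP; apply: h; apply/negP => vW.
  by have := disjointFr dis vW; rewrite vD.
- move=> i Pi; apply: le_trans (hsum i Pi).
  rewrite (exchange_big_dep P) /=; last by move=> w j _ /andP[].
  rewrite big_mkcond [leRHS]big_mkcond; apply: ler_sum => j _.
  (* A [j] in [nb i] shares some coordinate with [W i], so the double sum counts [p j] at least
     once. *)
  case Pj: (P j) => //=; case: ifPn => [/pred0Pn[w /andP[/= wW wD]]|_].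
    rewrite (bigD1 w) /=; last by apply/andP; split.
    by rewrite lerDl sumr_ge0 // => ? _; apply: p0.
  by rewrite sumr_ge0 // => ? _; apply: p0.
Qed.

(** * Random elements of a product *)

Section ProductFamily.

Variables (V T : finType) (F : V -> {set T}).

Definition prodset : {set {ffun V -> T}} := [set g : {ffun V -> T} | [forall v, g v \in F v]].

Lemma prodsetP (g : {ffun V -> T}) :
  reflect (forall v, g v \in F v) (g \in prodset).
Proof. by rewrite inE; apply: forallP. Qed.

Lemma sum_prodset (R : comNzRingType) (h : V -> T -> R) :
  \sum_(g in prodset) \prod_v h v (g v) = \prod_v \sum_(t in F v) h v t.
Proof.
rewrite bigA_distr_big_dep; apply: eq_bigl => g.
by apply/prodsetP/familyP.
Qed.

Lemma card_prodset : #|prodset| = (\prod_v #|F v|)%N.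
Proof.
have := @sum_prodset int (fun _ _ => 1).
rewrite big1_eq.
rewrite [RHS](eq_bigr (fun v => #|F v|%:R)) => [|v _]; last by rewrite sumr_const.
by rewrite sumr_const -natr_prod => /eqP; rewrite eqr_nat => /eqP.
Qed.

(* In each coordinate a killing value is at least as likely as a label, so the
   weight 0 / 2 / 1 of killing / labelled / other values has mean at most 1. *)
Lemma card_many_labels (Kl Lb : V -> {set T}) (n : nat) :
  (forall v, #|Lb v :&: F v| <= #|Kl v :&: F v|)%N ->
  (2 ^ n * #|[set g in prodset | [forall v, g v \notin Kl v] &&
      (n <= #|[set v | g v \in Lb v]|)]| <= #|prodset|)%N.
Proof.
move=> LK; set A := [set g in _ | _].
pose h v t : nat := if t \in Kl v then 0%N else if t \in Lb v then 2 else 1%N.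
(* Markov's inequality: an element of [A] has weight at least [2 ^ n], and the total weight
   factorises over the coordinates. *)
have le1 : (2 ^ n * #|A| <= \sum_(g in prodset) \prod_v h v (g v))%N.
  rewrite mulnC -sum_nat_const [leqRHS](bigID (mem A)) /=.
  apply: leq_trans (leq_addr _ _).
  rewrite [leqRHS](eq_bigl (mem A)); last first.
    by move=> g; rewrite !inE; case: [forall v, _] => //=; rewrite ?andbF.
  apply: leq_sum => g; rewrite !inE => /and3P[_ /forallP gK gL].
  apply: (@leq_trans (\prod_(v | g v \in Lb v) 2)%N).
    by rewrite prod_nat_const leq_exp2l //; rewrite cardsE in gL.
  rewrite [leqRHS](bigID (fun v => g v \in Lb v)) /=.
  rewrite [X in (_ <= X * _)%N](eq_bigr (fun _ => 2)); last first.
    by move=> v gv; rewrite /h (negbTE (gK v)) gv.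
  rewrite [X in (_ <= _ * X)%N]big1 ?muln1 // => v gv.
  by rewrite /h (negbTE (gK v)) (negbTE gv).
apply: leq_trans le1 _.
rewrite -(ler_nat int) natr_sum.
under eq_bigr do rewrite natr_prod.
rewrite (@sum_prodset int (fun v t => (h v t)%:R)).
rewrite card_prodset natr_prod; apply: ler_prod => v _.
rewrite sumr_ge0 //= -natr_sum ler_nat.
rewrite (bigID (mem (Kl v))) /= big1 ?add0n; last first.
  by move=> t /andP[_ tK]; rewrite /h tK.
rewrite (bigID (mem (Lb v))) /=.
rewrite (eq_bigr (fun _ => 2%N)); last first.
  by move=> t /andP[/andP[_ tK] tL]; rewrite /h (negbTE tK) tL.
rewrite [X in (_ + X)%N](eq_bigr (fun _ => 1%N)); last first.
  by move=> t /andP[/andP[_ tK] tL]; rewrite /h (negbTE tK) (negbTE tL).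
rewrite !sum_nat_const muln1.
rewrite -(cardID (mem (Kl v)) (mem (F v))).
rewrite -(cardID (mem (Lb v)) [predD F v & Kl v]).
set a := #|_|; set b := #|_|; set c := #|_|; set d := #|_|; set e := #|_|.
have -> : a = d.
  apply: eq_card => t; rewrite [LHS]unfold_in !inE.
  by case: (t \in Kl v); case: (t \in F v); case: (t \in Lb v).
have -> : b = e.
  apply: eq_card => t; rewrite [LHS]unfold_in !inE.
  by case: (t \in Kl v); case: (t \in F v); case: (t \in Lb v).
suff : (d <= c)%N by lia.
have -> : c = #|Kl v :&: F v|.
  by apply: eq_card => t; rewrite !inE andbC.
apply: leq_trans (LK v); apply: subset_leq_card; apply/subsetP => t.
by rewrite !inE; case: (t \in Lb v); case: (t \in F v); rewrite ?andbF.
Qed.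

End ProductFamily.

(** * Negative correlation of survival *)

Lemma prodrD_ge (R : realFieldType) (X : eqType) (r : seq X) (b d : X -> R) :
  uniq r -> (forall x, 0 <= b x) -> (forall x, 0 <= d x) ->
  \prod_(x <- r) b x + \sum_(x <- r) d x * \prod_(y <- r | y != x) b y <=
  \prod_(x <- r) (b x + d x).
Proof.
move=> + b0 d0; elim: r => [|z r IHr]; first by rewrite !big_nil addr0.
rewrite cons_uniq => /andP[zr /IHr{}IHr]; rewrite !big_cons eqxx /=.
have eq1 : \prod_(y <- r | y != z) b y = \prod_(y <- r) b y.
  rewrite big_seq_cond [RHS]big_seq_cond; apply: eq_bigl => y.
  by case: eqP => // ->; rewrite (negbTE zr).
have eq2 : \sum_(x <- r) d x * \prod_(y <- z :: r | y != x) b y =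
    b z * \sum_(x <- r) d x * \prod_(y <- r | y != x) b y.
  rewrite mulr_sumr big_seq_cond [RHS]big_seq_cond; apply: eq_bigr => x.
  rewrite andbT big_cons => xr; case: eqP => [zx|_] /=; last by ring.
  by rewrite zx xr in zr.
rewrite eq1 eq2.
have p0 : 0 <= \prod_(y <- r) b y by apply: prodr_ge0.
have s0 : 0 <= \sum_(x <- r) d x * \prod_(y <- r | y != x) b y.
  by apply: sumr_ge0 => x _; rewrite mulr_ge0 // prodr_ge0.
by have := b0 z; have := d0 z; nra.
Qed.

(** A single draw hits at most one element, so averaging over [t] yields just the terms of degree at
    most one in [d] of the product of the [b x + d x]. By [prodrD_ge] the average of the product is
    at most the product of the averages. *)
Lemma sum_prod_missed (R : realFieldType) (T X : finType) (A : {set T})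
    (S : {set X}) (k : T -> option X) (al : X -> R) :
  (forall x, 0 <= al x <= 1) -> A != set0 ->
  \sum_(t in A) \prod_(x in S) (1 - al x * (k t != Some x)%:R) <=
  #|A|%:R * \prod_(x in S)
     (1 - al x * (1 - #|[set t in A | k t == Some x]|%:R / #|A|%:R)).
Proof.
move=> al01 A0; set N : R := #|A|%:R.
have N0 : 0 < N by rewrite ltr0n card_gt0.
pose n x : R := #|[set t in A | k t == Some x]|%:R.
pose b x := 1 - al x.
have b0 x : 0 <= b x by have := al01 x; rewrite /b; lra.
pose d x := al x * (n x / N).
have d0 x : 0 <= d x.
  by rewrite /d mulr_ge0 ?divr_ge0 ?ler0n //; have /andP[] := al01 x.
rewrite (eq_bigr (fun x => b x + d x)); last by move=> x _; rewrite /b /d /n; ring.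
have := @prodrD_ge R _ (enum S) b d (enum_uniq _) b0 d0.
rewrite !big_enum /= => le1.
apply: le_trans (_ : N * (\prod_(x in S) b x +
   \sum_(x in S) d x * \prod_(y <- enum S | y != x) b y) <= _); last first.
  by rewrite ler_pM2l // (le_trans le1) // -big_enum.
rewrite le_eqVlt; apply/orP; left; apply/eqP.
have one t : t \in A -> \prod_(x in S) (1 - al x * (k t != Some x)%:R) =
   \prod_(x in S) b x +
   \sum_(x in S) (k t == Some x)%:R * (al x * \prod_(y <- enum S | y != x) b y).
  move=> _; case kt: (k t) => [x0|]; last first.
    rewrite [X in _ + X]big1 ?addr0 => [|x _]; last by rewrite mul0r.
    by apply: eq_bigr => x _; rewrite mulr1.
  have eqS x : (Some x0 == Some x) = (x == x0) by rewrite eq_sym.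
  case x0S: (x0 \in S); last first.
    rewrite [X in _ + X]big1 ?addr0 => [|x xS]; last first.
      by rewrite eqS; case: eqP => [xx|_]; [rewrite -xx xS in x0S | rewrite mul0r].
    apply: eq_bigr => x xS; rewrite eqS; case: eqP => [xx|_] /=; last by rewrite mulr1.
    by rewrite -xx xS in x0S.
  rewrite [X in _ + X](bigD1 x0) //= eqxx mul1r.
  rewrite [X in _ + (_ + X)]big1 ?addr0; last first.
    by move=> x /andP[_ nx]; rewrite eqS (negbTE nx) mul0r.
  rewrite (bigD1 x0) //= eqxx mulr0 subr0 mul1r.
  rewrite [X in _ = X + _](bigD1 x0) //=.
  have -> : \prod_(y <- enum S | y != x0) b y = \prod_(y in S | y != x0) b y.
    by rewrite big_enum_cond.
  rewrite (eq_bigr b); first by rewrite /b; ring.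
  by move=> x /andP[_ nx]; rewrite eqS (negbTE nx) mulr1.
rewrite (eq_bigr _ one) big_split /= sumr_const -/N mulrDr.
congr (_ + _); first by rewrite mulr_natl.
rewrite exchange_big /= mulr_sumr; apply: eq_bigr => x _.
rewrite -mulr_suml /d mulrA.
have -> : \sum_(t in A) (k t == Some x)%:R = n x.
  rewrite /n -sum1_card natr_sum [RHS](eq_bigl (fun t => (t \in A) && (k t == Some x))).
    by rewrite big_mkcondr /=; apply: eq_bigr => t _; case: eqP.
  by move=> t; rewrite inE.
by field; rewrite gt_eqF.
Qed.

Section RandomKilling.

Variables (R : realFieldType) (V T X : finType) (F : V -> {set T}).
Variables (k : V -> T -> option X) (S : {set X}).
Hypothesis F0 : forall v, F v != set0.

Let p (v : V) (x : X) : R :=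
  #|[set t in F v | k v t == Some x]|%:R / #|F v|%:R.

Definition survivors (g : {ffun V -> T}) : {set X} :=
  [set x in S | [forall v, k v (g v) != Some x]].

Let upd (g : {ffun V -> T}) (w : V) (t : T) : {ffun V -> T} :=
  [ffun v => if v == w then t else g v].

(** Exchanging [g w] with the fresh value [t] is an involution on pairs, so resampling a coordinate
    preserves the uniform distribution. *)
Lemma sum_resample (w : V) (phi : {ffun V -> T} -> R) :
  #|F w|%:R * \sum_(g in prodset F) phi g =
  \sum_(g in prodset F) \sum_(t in F w) phi (upd g w t).
Proof.
pose sw (c : {ffun V -> T} * T) := (upd c.1 w c.2, c.1 w).
have swK : involutive sw.
  case=> g t; rewrite /sw /= /upd !ffunE eqxx; congr (_, _).
  by apply/ffunP => v; rewrite !ffunE; case: eqP => // ->.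
pose Q (c : {ffun V -> T} * T) := (c.1 \in prodset F) && (c.2 \in F w).
have QS c : Q (sw c) = Q c.
  case: c => g t; rewrite /Q /sw /=; apply/andP/andP => -[/prodsetP h tw].
    split; last by have := h w; rewrite ffunE eqxx.
    by apply/prodsetP => v; have := h v; rewrite ffunE; case: eqP => // ->.
  by split; [apply/prodsetP => v; rewrite ffunE; case: eqP => // -> | exact: h].
rewrite pair_big /= [RHS](reindex_inj (inv_inj swK)) /=.
rewrite [RHS](eq_bigl Q) => [|c]; last exact: QS.
rewrite [RHS](eq_bigr (fun c => phi c.1)) => [|[g t] _]; last first.
  congr phi; apply/ffunP => v; rewrite !ffunE ?eqxx; case: eqP => // -> //.
rewrite -(pair_big (mem (prodset F)) (mem (F w)) (fun g _ => phi g)) /=.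
by rewrite mulr_sumr; apply: eq_bigr => g _; rewrite sumr_const mulr_natl.
Qed.

Let a (x : X) : R := \prod_v (1 - p v x).

Let p01 v x : 0 <= p v x <= 1.
Proof.
rewrite /p divr_ge0 ?ler0n //= ler_pdivrMr ?ltr0n ?card_gt0 // mul1r ler_nat.
by apply: subset_leq_card; apply/subsetP => t; rewrite inE => /andP[].
Qed.

(** Interpolates between [2^-1 ^+ #|survivors g|] ([U] everything) and the product for independent
    survival ([U] empty): coordinates in [U] are drawn, the others enter through [1 - p v x]. *)
Let phi (U : {set V}) (g : {ffun V -> T}) : R :=
  \prod_(x in S) (1 - 2^-1 * ([forall v in U, k v (g v) != Some x]%:R *
     \prod_(v | v \notin U) (1 - p v x))).

(** Averages over coordinate [w] alone by [sum_prod_missed]; [al] collects the factors that do not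
    depend on [g w]. *)
Lemma phi_step (U : {set V}) (w : V) : w \notin U ->
  \sum_(g in prodset F) phi (w |: U) g <= \sum_(g in prodset F) phi U g.
Proof.
move=> wU; have N0 : (0 : R) < #|F w|%:R by rewrite ltr0n card_gt0.
rewrite -(ler_pM2l N0) sum_resample mulr_sumr; apply: ler_sum => g gF.
pose al x : R := 2^-1 * ([forall v in U, k v (g v) != Some x]%:R *
   \prod_(v | (v \notin w |: U)) (1 - p v x)).
have al01 x : 0 <= al x <= 1.
  rewrite /al; set b : R := (nat_of_bool _)%:R; set c := \prod_(_ | _) _.
  have bb (y : bool) : 0 <= (y%:R : R) <= 1 by case: y; rewrite /= ?lexx ?ler01.
  have b01 : 0 <= b <= 1 by apply: bb.
  have c01 : 0 <= c <= 1.
    rewrite /c; apply/andP; split.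
      by apply: prodr_ge0 => v _; have := p01 v x; lra.
    by apply: prodr_ile1 => v _; have := p01 v x; lra.
  nra.
have := sum_prod_missed S (k w) al01 (F0 w).
rewrite (eq_bigr (fun t => phi (w |: U) (upd g w t))) => [|t tF]; last first.
  apply: eq_bigr => x xS; congr (1 - _); rewrite /al -mulrA; congr (_ * _).
  rewrite mulrAC -natrM mulnb; congr ((_ : bool)%:R * _).
  apply/andP/forall_inP => [[/forall_inP h kx] v|h].
    rewrite !inE ffunE; case: (eqVneq v w) => [->//|_] /=; exact: h.
  split; last by have := h w; rewrite ffunE eqxx setU11; apply.
  apply/forall_inP => v vU; have := h v; rewrite ffunE.
  by case: (eqVneq v w) => [vw|_]; [rewrite -vw vU in wU | apply; rewrite !inE vU orbT].
move=> /le_trans; apply; rewrite le_eqVlt; apply/orP; left; apply/eqP.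
congr (_ * _); apply: eq_bigr => x _; congr (1 - _).
rewrite /al -!mulrA; congr (_ * (_ * _)).
rewrite [RHS](bigD1 w) //= mulrC; congr (_ * _).
by apply: eq_bigl => v; rewrite !inE negb_or andbC.
Qed.

(* The availability of the elements of [S] is negatively correlated: the bound
   is that of independent survival with the same probabilities. *)
Lemma sum_survivors :
  \sum_(g in prodset F) 2^-1 ^+ #|survivors g| <=
  #|prodset F|%:R * \prod_(x in S) (1 - 2^-1 * a x).
Proof.
have mono (n : nat) (U : {set V}) : (#|U| <= n)%N ->
    \sum_(g in prodset F) phi U g <= \sum_(g in prodset F) phi set0 g.
  elim: n U => [|n IHn] U; first by rewrite leqn0 cards_eq0 => /eqP ->.
  have [->//|[w wU]] := set_0Vmem U.
  rewrite (cardsD1 w) wU ltnS => /IHn /(le_trans _); apply.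
  by rewrite -{1}(setD1K wU) phi_step // !inE eqxx.
have := mono _ setT (leqnn _).
rewrite (eq_bigr (fun g => 2^-1 ^+ #|survivors g|)) => [|g _]; last first.
  rewrite /phi (bigID (mem (survivors g))) /= [X in _ * X]big1 ?mulr1; last first.
    move=> x /andP[xS]; rewrite inE xS /= => nx.
    case: forall_inP => [h|_]; last by rewrite mul0r mulr0 subr0.
    by case/negP: nx; apply/forallP => v; apply: h.
  rewrite (eq_bigl (mem (survivors g))); last first.
    by move=> x; rewrite /= inE; case: (x \in S).
  rewrite (eq_bigr (fun _ => 2^-1)) => [|x]; first by rewrite prodr_const.
  rewrite /= inE => /andP[_ /forallP h]; rewrite big_pred0; last by move=> v; rewrite inE.
  have -> : [forall v in [set: V], k v (g v) != Some x].
    by apply/forall_inP => v _; apply: h.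
  by rewrite !mulr1; field.
move=> /le_trans; apply; rewrite [X in X <= _](eq_bigr (fun _ => \prod_(x in S) (1 - 2^-1 * a x))).
  by rewrite sumr_const mulr_natl.
move=> g _; apply: eq_bigr => x _; congr (1 - 2^-1 * _).
have -> : [forall v in set0, k v (g v) != Some x].
  by apply/forall_inP => v; rewrite inE.
by rewrite mul1r; apply: eq_bigl => v; rewrite inE.
Qed.

End RandomKilling.

(** * Random partial colourings *)

Lemma card_bigcup_le (J T : finType) (Q : pred J) (G : J -> {set T}) :
  (#|\bigcup_(j | Q j) G j| <= \sum_(j | Q j) #|G j|)%N.
Proof.
elim/big_ind2: _ => [|a b c d ab cd|//]; first by rewrite cards0.
by apply: leq_trans (leq_card_setU _ _) _; rewrite leq_add.
Qed.

Section PartialColourings.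

Variables (V X : finType) (e : rel V) (own : X -> V) (cf : rel X).
Variables (L : V -> {set X}) (nr : rel V).

Hypothesis e_sym : symmetric e.
Hypothesis e_tri : forall x y z, ~~ [&& e x y, e y z & e x z].
Hypothesis cf_sym : symmetric cf.
Hypothesis cf_e : forall x y, cf x y -> e (own x) (own y).
Hypothesis cf_match : forall x y y', cf x y -> cf x y' -> own y = own y' -> y = y'.
Hypothesis L_own : forall v x, x \in L v -> own x = v.
Hypothesis nr_sym : symmetric nr.

Implicit Types (f g : {ffun V -> option X}) (u v w z : V) (x y : X).

Definition sel f x := f (own x) == Some x.

Definition partials : {set {ffun V -> option X}} :=
  [set f : {ffun V -> option X} |
    [forall v, if f v is Some x then x \in L v else true] &&
    [forall x, forall y, [&& sel f x, sel f y & cf x y] ==> ~~ nr (own x) (own y)]].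

(** Whether [v] itself is coloured does not matter, so the notion can be used for coloured and
    uncoloured vertices alike. *)
Definition avail f v : {set X} :=
  [set x in L v | [forall y, sel f y && cf x y ==> ~~ nr v (own y)]].

Definition nbr v : {set V} := [set z | e v z && nr v z].

Lemma partialsP f : reflect
  ((forall v x, f v = Some x -> x \in L v) /\
   (forall x y, sel f x -> sel f y -> cf x y -> ~~ nr (own x) (own y)))
  (f \in partials).
Proof.
rewrite inE; apply: (iffP andP) => -[].
  move=> /forallP h1 /forallP h2; split.
    by move=> v x fv; have := h1 v; rewrite fv.
  by move=> x y sx sy cxy; have /forallP/(_ y)/implyP := h2 x; apply; rewrite sx sy.
move=> h1 h2; split; apply/forallP.
  by move=> v; case fv: (f v) => [x|//]; apply: h1.
by move=> x; apply/forallP => y; apply/implyP => /and3P[]; apply: h2.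
Qed.

Lemma availP f v x : reflect
  (x \in L v /\ forall y, sel f y -> cf x y -> ~~ nr v (own y)) (x \in avail f v).
Proof.
rewrite inE; apply: (iffP andP) => -[xL h]; split=> //.
  by move=> y sy cxy; move/forallP/(_ y)/implyP: h; apply; rewrite sy.
by apply/forallP => y; apply/implyP => /andP[]; apply: h.
Qed.

Lemma avail_L f v x : x \in avail f v -> x \in L v.
Proof. by case/availP. Qed.

Lemma partials_sel f v x : f \in partials -> f v = Some x -> own x = v /\ sel f x.
Proof.
move=> /partialsP[h _] fv; have ox := L_own (h _ _ fv).
by rewrite /sel ox fv.
Qed.

Lemma nbr_sym u v : (u \in nbr v) = (v \in nbr u).
Proof. by rewrite !inE e_sym nr_sym. Qed.

Lemma nbr_indep v z w : z \in nbr v -> e z w -> w \notin nbr v.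
Proof.
rewrite !inE => /andP[evz _] ezw; apply/negP => /andP[evw _].
by have := e_tri v z w; rewrite evz ezw evw.
Qed.

Definition fibre f v w : {set option X} :=
  if w \in nbr v then None |: [set Some x | x in avail f w] else [set f w].

Lemma fibre_off f v (g : {ffun V -> option X}) w :
  g \in prodset (fibre f v) -> w \notin nbr v -> g w = f w.
Proof.
by move=> /prodsetP/(_ w); rewrite /fibre => + /negbTE wN; rewrite wN inE => /eqP.
Qed.

Lemma fibre_on f v (g : {ffun V -> option X}) w x :
  g \in prodset (fibre f v) -> w \in nbr v -> g w = Some x -> x \in avail f w.
Proof.
move=> /prodsetP/(_ w); rewrite /fibre => + wN; rewrite wN => + gw.
by rewrite gw => /setU1P[//|/imsetP[y yA [->]]].
Qed.

(** By triangle-freeness [nbr v] is independent, so the choices at near neighbours of [v] do not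
    constrain one another and the conditional space is a full product. *)
Lemma fibreE f v : f \in partials ->
  [set g in partials | [forall (w | w \notin nbr v), g w == f w]] =
  prodset (fibre f v).
Proof.
move=> fP; have [fL fC] := partialsP _ fP.
apply/setP => g; rewrite [LHS]inE; apply/idP/idP => [|gF].
  move=> /andP[gP /forall_inP gf]; apply/prodsetP => w; rewrite /fibre; case: ifPn => wN; last first.
    by rewrite inE gf.
  have [gL gC] := partialsP _ gP.
  case gw: (g w) => [x|]; rewrite !inE // ; apply/imsetP; exists x => //.
  apply/availP; split=> [|y sy cxy]; first exact: gL gw.
  have ox := L_own (gL _ _ gw).
  have sgx : sel g x by rewrite /sel ox gw.
  have yN : own y \notin nbr v by apply: nbr_indep wN _; rewrite -ox cf_e.
  have sgy : sel g y by rewrite /sel (eqP (gf _ yN)).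
  by have := gC _ _ sgx sgy cxy; rewrite ox.
apply/andP; split; last first.
  by apply/forall_inP => w wN; rewrite (fibre_off gF).
have gL v' x : g v' = Some x -> x \in L v'.
  case: (boolP (v' \in nbr v)) => [vN gv|vN]; last by rewrite (fibre_off gF) //; apply: fL.
  by apply: (avail_L (fibre_on gF vN gv)).
apply/partialsP; split=> // x y sx sy cxy.
have exy := cf_e cxy.
case: (boolP (own x \in nbr v)) => xN.
  have yN := nbr_indep xN exy.
  have /availP[_] := fibre_on gF xN (eqP sx).
  by apply=> //; rewrite /sel -(fibre_off gF yN).
case: (boolP (own y \in nbr v)) => yN.
  have /availP[_] := fibre_on gF yN (eqP sy).
  by rewrite nr_sym; apply; [rewrite /sel -(fibre_off gF xN) | rewrite cf_sym].
by apply: fC => //; rewrite /sel -(fibre_off gF).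
Qed.

(** The colours that decide [avail f z] sit outside [nbr v], again because [nbr v] is
    independent. *)
Lemma avail_fibre f g v z : g \in prodset (fibre f v) -> z \in nbr v ->
  avail g z = avail f z.
Proof.
move=> gF zN.
have h x y : x \in L z -> cf x y -> sel g y = sel f y.
  move=> xL cxy; rewrite /sel (fibre_off gF) //.
  by apply: (nbr_indep zN); rewrite -(L_own xL) cf_e.
apply/setP => x; apply/availP/availP => -[xL hx]; split=> // y sy cxy;
  apply: hx => //; move: sy; by rewrite (h x).
Qed.

Definition kill v w (t : option X) : option X :=
  if w \in nbr v then
    if t is Some y then [pick x in L v | cf x y] else None
  else None.

Lemma killP v w t x : x \in L v ->
  reflect (w \in nbr v /\ exists2 y, t = Some y & cf x y) (kill v w t == Some x).
Proof.
move=> xL; rewrite /kill; case: ifP => wN; last by constructor=> -[].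
case: t => [y|]; last by constructor=> -[_ [y]].
case: pickP => [x' /andP[xL' cxy']|h].
  apply: (iffP eqP) => [[<-]|[_ [_ [<-] cxy]]]; first by split=> //; exists y.
  congr Some; apply: (@cf_match y); rewrite ?(cf_sym y) //.
  by rewrite (L_own xL) (L_own xL').
constructor=> -[_ [_ [<-] cxy]].
by have := h x; rewrite xL cxy.
Qed.

Lemma avail_survivors f g v : g \in prodset (fibre f v) ->
  avail g v = survivors (kill v) (L v) g.
Proof.
move=> gF; apply/setP => x; rewrite [in RHS]inE.
apply/availP/andP => [[xL h]|[xL /forallP h]]; split=> //.
  apply/forallP => w; apply/negP => /(killP _ _ xL)[wN [y gw cxy]].
  have oy : own y = w by have /avail_L/L_own := fibre_on gF wN gw.
  have sy : sel g y by rewrite /sel oy gw.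
  have := h _ sy cxy.
  by move: wN; rewrite inE -oy => /andP[_ ->].
move=> y sy cxy; apply/negP => nvy.
have := h (own y); apply/negP; rewrite negbK; apply/killP => //; split.
  by rewrite inE nvy andbT -(L_own xL) cf_e.
by exists y => //; apply/eqP.
Qed.

Lemma card_fibre_on f v w : w \in nbr v -> #|fibre f v w| = #|avail f w|.+1.
Proof.
move=> wN; rewrite /fibre wN cardsU1 card_imset; last by move=> x y [].
by case: imsetP => [[]|_].
Qed.

Lemma fibre_neq0 f v w : fibre f v w != set0.
Proof.
rewrite /fibre; case: ifP => _; first by apply/set0Pn; exists None; rewrite setU11.
by apply/set0Pn; exists (f w); rewrite inE.
Qed.

Lemma card_kill f v w x : x \in L v -> w \in nbr v ->
  #|[set t in fibre f v w | kill v w t == Some x]| =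
  [exists y in avail f w, cf x y] :> nat.
Proof.
move=> xL wN; case: exists_inP => [[y yA cxy]|h].
  rewrite (_ : [set t in _ | _] = [set Some y]) ?cards1 //.
  apply/setP => t; rewrite !inE /fibre wN; apply/andP/eqP.
    move=> [tF /(killP _ _ xL)[_ [y' tE cxy']]]; rewrite tE.
    move: tF; rewrite tE !inE /= => /imsetP[y'' yA' [yy]].
    congr Some; apply: (cf_match cxy') => //.
    by rewrite yy (L_own (avail_L yA)) (L_own (avail_L yA')).
  move=> ->; split; last by apply/killP => //; split=> //; exists y.
  by rewrite !inE /=; apply: imset_f.
rewrite (_ : [set t in _ | _] = set0) ?cards0 //.
apply/setP => t; rewrite !inE; apply/negP => /andP[tF /(killP _ _ xL)[_ [y tE cxy]]].
apply: h; exists y => //; move: tF; rewrite /fibre wN tE.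
by case/setU1P => [//|/imsetP[? ? [->]]].
Qed.

(* A label is [None] (uncoloured) or [Some y] (coloured in conflict with y). *)
Definition labelled (lam : option X) (t : option X) : bool :=
  match lam, t with
  | None, None => true
  | Some y, Some x => cf x y
  | _, _ => false
  end.

Definition label_degree f v x (lam : option X) : nat :=
  #|[set z in nbr v | labelled lam (f z) && [exists y in avail f z, cf x y]]|.

Lemma card_label f v z lam : z \in nbr v ->
  (#|[set t | labelled lam t] :&: fibre f v z| <= 1)%N.
Proof.
move=> zN; suff [t0 h] : exists t0, forall t, t \in [set t | labelled lam t] :&: fibre f v z -> t = t0.
  by rewrite -(cards1 t0) subset_leq_card //; apply/subsetP => t /h ->; rewrite inE.
case: lam => [y|]; last by exists None => -[x|]; rewrite !inE.
have [x0 /andP[xA cxy]|h] := pickP [pred x in avail f z | cf x y].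
  exists (Some x0) => -[x|]; last by rewrite !inE.
  rewrite /fibre zN !inE /= => /andP[cxy' /imsetP[x' xA' [xx]]].
  congr Some; apply: (@cf_match y); rewrite ?(cf_sym y) //.
  by rewrite xx (L_own (avail_L xA)) (L_own (avail_L xA')).
exists None => -[x|//]; rewrite /fibre zN !inE /= => /andP[cxy /imsetP[x' xA [xx]]].
by have := h x'; rewrite /= xA -xx cxy.
Qed.

(** Every neighbour counted by [label_degree] has a value that kills [x] and at most one labelled
    value, so [card_many_labels] applies. *)
Lemma label_degree_bound f v x lam (n : nat) : f \in partials -> x \in L v ->
  (2 ^ n * #|[set g in prodset (fibre f v) |
     (x \in avail g v) && (n <= label_degree g v x lam)]| <=
   #|prodset (fibre f v)|)%N.
Proof.
move=> fP xL.
pose good z := (z \in nbr v) && [exists y in avail f z, cf x y].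
pose Kl z : {set option X} := [set t | kill v z t == Some x].
pose Lb z : {set option X} := if good z then [set t | labelled lam t] else set0.
have LK z : (#|Lb z :&: fibre f v z| <= #|Kl z :&: fibre f v z|)%N.
  rewrite /Lb; case: ifP => [/andP[zN h]|_]; last by rewrite set0I cards0.
  apply: leq_trans (card_label _ _ zN) _.
  have := card_kill f xL zN; rewrite h /= => <-.
  by apply: subset_leq_card; apply/subsetP => t; rewrite !inE andbC.
apply: leq_trans (card_many_labels n LK); rewrite leq_mul2l; apply/orP; right.
apply: subset_leq_card; apply/subsetP => g; rewrite [in X in X -> _]inE.
move=> /and3P[gF xA ld]; rewrite inE gF /=; apply/andP; split.
  move: xA; rewrite (avail_survivors gF) inE => /andP[_ /forallP h].
  by apply/forallP => w; rewrite inE.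
apply: leq_trans ld _; apply: subset_leq_card; apply/subsetP => z.
rewrite inE => /and3P[zN lz h].
by rewrite inE /Lb /good zN -(avail_fibre gF zN) h inE.
Qed.

(** * How many colours stay available *)

Section Retention.

Variable R : realType.

(** An upper bound for minus the logarithm of the probability that [x] survives the choices at
    [nbr v]. *)
Definition load f v x : R :=
  \sum_(z in nbr v) [exists y in avail f z, cf x y]%:R / #|avail f z|%:R.

Lemma load_ge0 f v x : 0 <= load f v x.
Proof. by apply: sumr_ge0 => z _; rewrite divr_ge0 ?ler0n. Qed.

(** All of [A] belongs to one vertex, so the matching condition makes the choice of a conflicting
    partner in [B] injective. *)
Lemma card_matched (A B : {set X}) v : (forall x, x \in A -> own x = v) ->
  (#|[set x in A | [exists y in B, cf x y]]| <= #|B|)%N.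
Proof.
move=> Av; pose h x := odflt x [pick y in B | cf x y].
have hP x : x \in [set x in A | [exists y in B, cf x y]] -> h x \in B /\ cf x (h x).
  rewrite inE => /andP[_ /exists_inP[y yB cxy]]; rewrite /h.
  by case: pickP => [y' /andP[]|/(_ y)] //; rewrite yB cxy.
rewrite -(@card_in_imset _ _ h).
  by apply: subset_leq_card; apply/subsetP => _ /imsetP[x /hP[hB _] ->].
move=> x x' xA xA' hh; have [_ c1] := hP _ xA; have [_ c2] := hP _ xA'.
apply: (@cf_match (h x)); [by rewrite cf_sym | by rewrite cf_sym hh|].
by move: xA xA'; rewrite !inE => /andP[xA _] /andP[xA' _]; rewrite !Av.
Qed.

(** Each neighbour [z] contributes at most 1: its available colours are in conflict with at most as
    many colours of [v]. *)
Lemma sum_load f v : \sum_(x in L v) load f v x <= #|nbr v|%:R.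
Proof.
rewrite /load exchange_big /= -sum1_card natr_sum; apply: ler_sum => z zN.
rewrite -mulr_suml.
have [->|A0] := posnP #|avail f z|; first by rewrite invr0 mulr0 ler01.
rewrite ler_pdivrMr ?ltr0n // mul1r -natr_sum ler_nat.
apply: leq_trans (@card_matched (L v) _ v _).
- rewrite -sum1_card [leqRHS](eq_bigl (fun x => (x \in L v) && [exists y in avail f z, cf x y])).
    by rewrite big_mkcondr /=; apply: leq_sum => x _; case: [exists _ in _, _].
  by move=> x; rewrite inE.
- by move=> x /L_own.
Qed.

Lemma survival_ge f v x : x \in L v ->
  expR (- load f v x) <= \prod_w
    (1 - #|[set t in fibre f v w | kill v w t == Some x]|%:R / #|fibre f v w|%:R).
Proof.
move=> xL; rewrite /load -sumrN [leRHS](bigID (mem (nbr v))) /= [X in _ <= _ * X]big1 ?mulr1.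
  rewrite expR_sum; apply: ler_prod => w wN; rewrite expR_ge0 /=.
  rewrite (card_kill _ xL wN) card_fibre_on //.
  case: exists_inP => [[y yA _]|_] /=; last by rewrite !mul0r oppr0 expR0 addr0.
  have n0 : (0 : R) < #|avail f w|%:R by rewrite ltr0n card_gt0; apply/set0Pn; exists y.
  rewrite -[(#|avail f w|.+1)%:R]natr1; set n : R := #|_|%:R in n0 *.
  (* With [n] available colours and the value [None], survival has probability
     [1 - 1/(n+1) = 1/(1 + 1/n)], which is at least [exp(-1/n)]. *)
  rewrite (_ : 1 - _ / _ = (1 + 1 / n)^-1) /=; last by field; rewrite !gt_eqF //; lra.
  have n1 : 0 < 1 / n by rewrite divr_gt0.
  by rewrite expRN lef_pV2 ?expR_ge1Dx // posrE ?expR_gt0 //; lra.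
move=> w wN; rewrite (_ : [set t in _ | _] = set0) ?cards0 ?mul0r ?subr0 //.
by apply/setP => t; rewrite !inE /kill (negbTE wN) andbF.
Qed.

(** Markov's inequality for [2^-1] to the number of survivors of load at most [tau]. Each survives
    with probability at least [expR (- tau)], and [sum_survivors] allows the factors to be
    multiplied as if independent. *)
Lemma card_few_avail f v (n : nat) (tau : R) :
  #|[set g in prodset (fibre f v) | (#|avail g v| < n)%N]|%:R <=
  2 ^+ n * expR (- (2^-1 * (#|[set x in L v | load f v x <= tau]|%:R * expR (- tau)))) *
  #|prodset (fibre f v)|%:R.
Proof.
set S := [set x in L v | _]; set G := [set g in _ | _].
have SL x : x \in S -> x \in L v by rewrite inE => /andP[].
have := @sum_survivors R _ _ _ (fibre f v) (kill v) S (fibre_neq0 f v).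
set P := prodset _; set a := (X in _ <= _ * \prod_(x in S) (X x)); move=> le1.
have : #|G|%:R * 2^-1 ^+ n <= \sum_(g in P) 2^-1 ^+ #|survivors (kill v) S g| :> R.
  rewrite mulr_natl -sumr_const [leRHS](bigID (mem G)) /=.
  apply: le_trans (_ : \sum_(g in P | g \in G) 2^-1 ^+ #|survivors (kill v) S g| <= _); last first.
    by rewrite lerDl; apply: sumr_ge0 => g _; rewrite exprn_ge0 // invr_ge0.
  rewrite [leRHS](eq_bigl (mem G)); last first.
    by move=> g; apply: andb_idl; rewrite /= inE => /andP[].
  apply: ler_sum => g; rewrite inE => /andP[gP ltn].
  apply: ler_wiXn2l; rewrite ?invr_ge0 ?invf_le1 ?ler1n //.
  apply: leq_trans (ltnW ltn); rewrite (avail_survivors gP); apply: subset_leq_card.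
  by apply/subsetP => x; rewrite !inE => /andP[/andP[-> _] ->].
move=> /le_trans/(_ le1) le2.
have : \prod_(x in S) a x <= expR (- (2^-1 * (#|S|%:R * expR (- tau)))).
  rewrite mulr_natl -sumr_const mulr_sumr -sumrN expR_sum.
  apply: ler_prod => x xS; rewrite /a /=.
  have := survival_ge f (SL _ xS); set b := \prod_w _ => le3.
  have b1 : b <= 1.
    apply: prodr_ile1 => w _; rewrite subr_ge0 lerBlDr lerDl divr_ge0 ?ler0n // andbT.
    rewrite ler_pdivrMr ?mul1r ?ltr0n ?card_gt0 ?fibre_neq0 // ler_nat.
    by apply: subset_leq_card; apply/subsetP => t; rewrite inE => /andP[].
  have le4 : expR (- tau) <= b.
    apply: le_trans le3; rewrite ler_expR lerN2.
    by move: xS; rewrite inE => /andP[].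
  have := expR_gt0 (- tau); move=> e0; apply/andP; split; first lra.
  apply: le_trans (expR_ge1Dx _); lra.
move=> le3; have P0 : (0 : R) <= #|P|%:R by [].
have le4 := ler_wpM2l P0 le3.
have := le_trans le2 le4; rewrite exprVn ler_pdivrMr ?exprn_gt0 //.
by move=> /le_trans; apply; rewrite le_eqVlt; apply/orP; left; apply/eqP; ring.
Qed.

Definition bad_at (n t : nat) (Lam : {set option X}) v : {set {ffun V -> option X}} :=
  [set f | (#|avail f v| < n)%N ||
     [exists x in avail f v, [exists lam in Lam, (t <= label_degree f v x lam)%N]]].

(** Union bound: too few available colours, or one of [#|L v| * #|Lam|] pairs of a colour and a
    label with large label degree. *)
Lemma card_bad_at (n t : nat) (Lam : {set option X}) f v (p tau : R) : f \in partials ->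
  2 ^+ n * expR (- (2^-1 * (#|[set x in L v | load f v x <= tau]|%:R * expR (- tau)))) +
    (#|L v| * #|Lam|)%:R / 2 ^+ t <= p ->
  #|[set g in bad_at n t Lam v :&: partials |
     [forall (w | w \notin nbr v), g w == f w]]|%:R <=
  p * #|[set g in partials | [forall (w | w \notin nbr v), g w == f w]]|%:R.
Proof.
move=> fP hp; rewrite fibreE // (_ : [set g in _ | _] =
  [set g in prodset (fibre f v) | g \in bad_at n t Lam v]); last first.
  have setI_sep (F : finType) (A B : {set F}) (C : pred F) :
      [set g in A :&: B | C g] = [set g in [set g in B | C g] | g \in A].
    by apply/setP => g; rewrite !inE; case: (g \in A); rewrite /= ?andbF ?andbT.
  by rewrite setI_sep fibreE.
set P := prodset _; set A := [set g in P | _].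
pose A1 := [set g in P | (#|avail g v| < n)%N].
pose A2 x lam := [set g in P | (x \in avail g v) && (t <= label_degree g v x lam)%N].
have sub : A \subset A1 :|: \bigcup_(x in L v) \bigcup_(lam in Lam) A2 x lam.
  apply/subsetP => g; rewrite inE => /andP[gP]; rewrite inE => /orP[h|].
    by apply/setUP; left; rewrite inE gP h.
  move=> /exists_inP[x xA /exists_inP[lam lL h]]; apply/setUP; right.
  apply/bigcupP; exists x; first exact: avail_L xA.
  by apply/bigcupP; exists lam => //; rewrite inE gP xA h.
have A2le x lam : x \in L v -> (#|A2 x lam|%:R : R) <= (2 ^+ t)^-1 * #|P|%:R.
  move=> xL; have := label_degree_bound lam t fP xL (v := v).
  rewrite -(ler_nat R) natrM natrX => h.
  by rewrite ler_pdivlMl ?exprn_gt0.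
apply: le_trans (ler_wpM2r (ler0n _ _) hp).
have : (#|A| <= #|A1| + \sum_(x in L v) \sum_(lam in Lam) #|A2 x lam|)%N.
  apply: leq_trans (subset_leq_card sub) _; apply: leq_trans (leq_card_setU _ _) _.
  rewrite leq_add2l.
  apply: leq_trans (card_bigcup_le _ _) _; apply: leq_sum => x _.
  exact: card_bigcup_le.
rewrite -(ler_nat R) natrD natr_sum => /le_trans; apply.
rewrite mulrDl lerD ?card_few_avail //.
apply: le_trans (_ : \sum_(x in L v) \sum_(lam in Lam) ((2 ^+ t)^-1 * #|P|%:R) <= _).
  by apply: ler_sum => x xL; rewrite natr_sum; apply: ler_sum => lam _; apply: A2le.
under eq_bigr do rewrite sumr_const.
rewrite sumr_const -mulrnA -[leLHS]mulr_natr !natrM.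
by rewrite le_eqVlt; apply/orP; left; apply/eqP; ring.
Qed.

End Retention.

(** * Locality of the events, and simultaneous hits *)

Lemma avail_local f g v : {in nbr v, f =1 g} -> avail f v = avail g v.
Proof.
suff sub f1 g1 : {in nbr v, f1 =1 g1} -> avail f1 v \subset avail g1 v.
  by move=> fg; apply/eqP; rewrite eqEsubset !sub // => w /fg.
move=> fg; apply/subsetP => x /availP[xL h]; apply/availP; split=> // y sy cxy.
apply/negP => nvy; have := h y; rewrite /sel fg; last first.
  by rewrite inE nvy andbT -(L_own xL) cf_e.
by move=> /(_ sy cxy); rewrite nvy.
Qed.

(** The second neighbourhood enters because [label_degree] looks at the available colours of
    neighbours. *)
Definition event_dom v : {set V} := nbr v :|: \bigcup_(z in nbr v) nbr z.

Lemma bad_at_local n t Lam f g v : {in event_dom v, f =1 g} ->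
  (f \in bad_at n t Lam v) = (g \in bad_at n t Lam v).
Proof.
move=> fg; have fg1 : {in nbr v, f =1 g}.
  by move=> w wN; apply: fg; rewrite inE wN.
have av := avail_local fg1.
have az z : z \in nbr v -> avail f z = avail g z.
  move=> zN; apply: avail_local => w wN; apply: fg; rewrite inE; apply/orP; right.
  by apply/bigcupP; exists z.
have ld x lam : label_degree f v x lam = label_degree g v x lam.
  apply: eq_card => z; rewrite [LHS]inE [RHS]inE; case zN: (z \in nbr v) => //=.
  by rewrite fg1 // az.
rewrite [LHS]inE [RHS]inE av; congr (_ || _); apply: eq_existsb => x.
by congr (_ && _); apply: eq_existsb => lam; rewrite ld.
Qed.

(** Having [n] available colours at the owners is part of the event, which keeps its conditional
    probability small whatever the surroundings; where this fails, a [bad_at] event occurs. *)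
Definition hit_event (n : nat) (Y : {set X}) : {set {ffun V -> option X}} :=
  [set f | [forall y in Y, sel f y && (n <= #|avail f (own y)|)%N]].

Definition hit_dom (Y : {set X}) : {set V} :=
  \bigcup_(y in Y) (own y |: nbr (own y)).

Lemma hit_event_local n Y f g : {in hit_dom Y, f =1 g} ->
  (f \in hit_event n Y) = (g \in hit_event n Y).
Proof.
move=> fg; rewrite [LHS]inE [RHS]inE; apply: eq_forallb => y.
case yY: (y \in Y) => //=; congr (_ && _).
  by rewrite /sel fg //; apply/bigcupP; exists y; rewrite ?setU11.
rewrite (@avail_local f g) // => w wN; apply: fg; apply/bigcupP; exists y => //.
by rewrite inE wN orbT.
Qed.

Let upd f u x : {ffun V -> option X} := [ffun v => if v == u then Some x else f v].

Lemma upd_partials f g u x : f \in partials -> g \in partials -> x \in avail f u ->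
  (forall x', sel g x' -> cf x x' -> sel f x' \/ own x' = u) ->
  upd g u x \in partials.
Proof.
move=> fP gP xA h; have [gL gC] := partialsP _ gP; have [xL xC] := availP _ _ _ xA.
have key b : cf x b -> sel (upd g u x) b -> ~~ nr u (own b).
  move=> cxb; rewrite /sel ffunE; case: (eqVneq (own b) u) => [obu _|nbu sb].
    have := cf_e cxb; rewrite obu (L_own xL).
    by have := e_tri u u u; case: (e u u).
  by have [sfb|/eqP] := h _ sb cxb; [exact: xC | rewrite (negbTE nbu)].
have selu a : own a = u -> sel (upd g u x) a -> a = x.
  by move=> oa; rewrite /sel ffunE oa eqxx => /eqP[].
apply/partialsP; split=> [v y|a b sa sb cab].
  by rewrite ffunE; case: (eqVneq v u) => [-> [<-]|_ /gL].
case: (eqVneq (own a) u) => [ou|nu].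
  by rewrite ou; apply: key => //; rewrite -(selu a).
case: (eqVneq (own b) u) => [ou|nu'].
  by rewrite nr_sym ou; apply: key => //; rewrite -(selu b) // cf_sym.
by apply: gC => //; [move: sa|move: sb]; rewrite /sel ffunE ?(negbTE nu) ?(negbTE nu').
Qed.

(** The event prescribes the colours at the owners of [Y], so at most one extension satisfies it.
    Recolouring the owners in turn yields the many extensions: each has [n] available colours, and
    every owner treated before blocks at most one of them. *)
Lemma card_hit_event (n : nat) (Y : {set X}) f :
  ((n - #|Y|) ^ #|Y| *
   #|[set g in hit_event n Y :&: partials |
      [forall (w | w \notin own @: Y), g w == f w]]| <=
   #|[set g in partials | [forall (w | w \notin own @: Y), g w == f w]]|)%N.
Proof.
set E := [set g in _ :&: _ | _].
have [->|[g0]] := set_0Vmem E; first by rewrite cards0 muln0.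
have EP g : g \in E -> [/\ g \in partials, {in Y, forall y, sel g y /\ (n <= #|avail g (own y)|)%N} &
    forall w, w \notin own @: Y -> g w = f w].
  rewrite inE => /andP[/setIP[]]; rewrite inE => /forall_inP h gP /forall_inP h'.
  split=> //; first by move=> y /h /andP[].
  by move=> w /h'/eqP.
move=> /EP[g0P g0Y g0f].
have -> : #|E| = 1%N.
  have g0E : E = [set g0].
    apply/setP => g; rewrite in_set1; apply/idP/eqP => [/EP[gP gY gf]|->].
      apply/ffunP => w; case: (boolP (w \in own @: Y)) => [/imsetP[y yY ->]|wY].
        by have [/eqP -> _] := gY _ yY; have [/eqP -> _] := g0Y _ yY.
      by rewrite gf // g0f.
    rewrite inE; apply/andP; split; last by apply/forall_inP => w /g0f ->.
    apply/setIP; split=> //; rewrite inE; apply/forall_inP => y /g0Y[-> ->] //.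
  by rewrite g0E cards1.
rewrite muln1.
pose Ext (Z : {set X}) := [set g in partials |
   [forall (w | w \notin own @: Z), g w == g0 w]].
have -> : [set g in partials | [forall (w | w \notin own @: Y), g w == f w]] = Ext Y.
  apply/setP => g; rewrite [LHS]inE [RHS]inE; congr (_ && _).
  by apply: eq_forallb => w; case wY: (w \in own @: Y) => //=; rewrite g0f ?wY.
suff h (Z : {set X}) : Z \subset Y -> ((n - #|Y|) ^ #|Z| <= #|Ext Z|)%N by apply: h.
have [m] := ubnP #|Z|; elim: m Z => // m IHm Z ltZ ZY.
have [->|[y yZ]] := set_0Vmem Z.
  rewrite cards0 expn0 card_gt0; apply/set0Pn; exists g0; rewrite inE g0P /=.
  by apply/forall_inP.
have yY : y \in Y by apply: (subsetP ZY).
pose Z' := Z :\ y; have Z'Y : Z' \subset Y by apply: subset_trans ZY; apply: subD1set.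
have cZ : #|Z| = #|Z'|.+1 by rewrite (cardsD1 y) yZ.
have {IHm} IH := IHm Z' _ Z'Y; rewrite cZ ltnS in ltZ; move: IH => /(_ ltZ) IH.
have [sy ny] := g0Y _ yY; set u := own y.
have uZ' : u \notin own @: Z'.
  apply/imsetP => -[y' /setD1P[nyy y'Z] ou]; have [sy' _] := g0Y _ (subsetP ZY _ y'Z).
  by case/negP: nyy; move: sy sy'; rewrite /sel -ou => /eqP -> /eqP[->].
pose blocked g y' : {set X} := [set x in avail g0 u | [exists x' in
   [set x' | sel g x' && (own x' == own y')], cf x x']].
pose good g := avail g0 u :\: \bigcup_(y' in Z') blocked g y'.
have goodn g : (n - #|Y| <= #|good g|)%N.
  rewrite cardsD.
  have le1 : (#|avail g0 u :&: \bigcup_(y' in Z') blocked g y'| <= #|Z'|)%N.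
    apply: leq_trans (subset_leq_card (subsetIr _ _)) _.
    apply: leq_trans (card_bigcup_le _ _) _; rewrite -sum1_card; apply: leq_sum => y' _.
    apply: leq_trans (@card_matched _ _ u _) _.
    - by move=> x /avail_L/L_own.
    rewrite -(cards1 (odflt y' (g (own y')))) subset_leq_card //.
    by apply/subsetP => x'; rewrite !inE /sel => /andP[/eqP + /eqP o]; rewrite o => ->.
  have : (#|Z'| <= #|Y|)%N by apply: subset_leq_card.
  move: ny le1; rewrite -/u; lia.
rewrite cZ expnSr; apply: leq_trans (leq_mul IH (leqnn _)) _.
apply: leq_trans (_ : \sum_(g in Ext Z') #|good g| <= _)%N.
  by rewrite -sum_nat_const; apply: leq_sum => g _; apply: goodn.
have -> : (\sum_(g in Ext Z') #|good g| =
    #|[set c | (c.1 \in Ext Z') && (c.2 \in good c.1)]|)%N.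
  rewrite -sum1_card (eq_bigl (fun c => (c.1 \in Ext Z') && (c.2 \in good c.1))).
    rewrite -(pair_big_dep (mem (Ext Z')) (fun g x => x \in good g) (fun _ _ => 1%N)) /=.
    by apply: eq_bigr => g _; rewrite sum1_card.
  by move=> c; rewrite inE.
have ExtP g : g \in Ext Z' -> g \in partials /\ g u = Some y.
  rewrite inE => /andP[gP /forall_inP h]; split=> //.
  by rewrite (eqP (h _ uZ')); apply/eqP.
(* The update is injective: [g] is recovered from it because its old value at [u] is known to be
   [Some y]. *)
rewrite -(@card_in_imset _ _ (fun c => upd c.1 u c.2)).
  apply: subset_leq_card; apply/subsetP => _ /imsetP[[g x] + ->].
  rewrite inE /= => /andP[gE]; have [gP gu] := ExtP _ gE.
  move=> /setDP[xA xB]; rewrite inE; apply/andP; split.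
    apply: (upd_partials g0P gP xA) => x' sx' cxx'.
    case: (boolP (own x' \in own @: Z')) => [/imsetP[y' y'Z oy]|nZ].
      case/negP: xB; apply/bigcupP; exists y' => //; rewrite inE xA /=.
      by apply/exists_inP; exists x' => //; rewrite inE sx' oy /=.
    left; move: gE; rewrite inE => /andP[_ /forall_inP h].
    by move: sx'; rewrite /sel (eqP (h _ nZ)).
  apply/forall_inP => w wZ; rewrite ffunE; case: (eqVneq w u) => [wu|nwu].
    by case/negP: wZ; rewrite wu; apply: imset_f.
  move: gE; rewrite inE => /andP[_ /forall_inP h]; apply: h.
  apply: contra wZ => /imsetP[y' /setD1P[_ y'Z] ->]; exact: imset_f.
have CE c : c \in [set c | (c.1 \in Ext Z') && (c.2 \in good c.1)] -> c.1 \in Ext Z'.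
  by rewrite inE => /andP[].
move=> [g x] [g' x'] /CE/= gE /CE/= gE'.
have [_ gu] := ExtP _ gE; have [_ gu'] := ExtP _ gE'.
move=> /ffunP eqg; congr (_, _); last first.
  by have := eqg u; rewrite !ffunE eqxx => -[].
apply/ffunP => w; have := eqg w; rewrite !ffunE.
by case: (eqVneq w u) => [->|//]; rewrite gu gu'.
Qed.

End PartialColourings.

(** * Scales *)

Definition dexp (i : nat) : nat := (2 ^ 2 ^ i)%N.

Lemma dexp_gt0 i : (0 < dexp i)%N. Proof. by rewrite expn_gt0. Qed.

Lemma dexp_gt1 i : (1 < dexp i)%N.
Proof. by rewrite -{1}(expn0 2) ltn_exp2l // expn_gt0. Qed.

Lemma leq_dexp i j : (i <= j)%N -> (dexp i <= dexp j)%N.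
Proof. by move=> ij; rewrite /dexp leq_exp2l // leq_exp2l. Qed.

Lemma dexpS i : dexp i.+1 = (dexp i * dexp i)%N.
Proof. by rewrite /dexp expnS mul2n -addnn expnD. Qed.

Lemma dexp_expn i j : (dexp i ^ 2 ^ j = dexp (i + j))%N.
Proof. by rewrite /dexp -expnM -expnD. Qed.

(** One scale absorbs a product, or in [add_dexp] a sum, of numbers of lower scales. With
    [idexp_absorb] this turns most estimates below into linear inequalities between indices. *)
Lemma mul_dexp m n i j k : (m <= dexp i)%N -> (n <= dexp j)%N ->
  (i < k)%N -> (j < k)%N -> (m * n <= dexp k)%N.
Proof.
case: k => // k mi nj; rewrite !ltnS => ik jk; rewrite dexpS leq_mul //.
  exact: leq_trans mi (leq_dexp ik).
exact: leq_trans nj (leq_dexp jk).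
Qed.

Lemma add_dexp m n i j k : (m <= dexp i)%N -> (n <= dexp j)%N ->
  (i < k)%N -> (j < k)%N -> (m + n <= dexp k)%N.
Proof.
case: k => // k mi nj; rewrite !ltnS => ik jk; rewrite dexpS.
apply: (@leq_trans (dexp k + dexp k)).
  by rewrite leq_add // (leq_trans mi, leq_trans nj) ?leq_dexp.
by rewrite addnn -mul2n leq_mul // dexp_gt1.
Qed.

Lemma ler_sum_subpred (R : numDomainType) (I : finType) (P Q : pred I) (F : I -> R) :
  (forall i, P i -> Q i) -> (forall i, Q i -> 0 <= F i) ->
  \sum_(i | P i) F i <= \sum_(i | Q i) F i.
Proof.
move=> PQ F0; rewrite [leRHS](bigID P) /= [X in _ <= X + _](eq_bigl P).
  by rewrite lerDl; apply: sumr_ge0 => i /andP[/F0].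
by move=> i; apply: andb_idl => /PQ.
Qed.

(** * Reciprocals of double exponentials *)

Section InverseDexp.

Variable R : realFieldType.

Definition idexp (i : nat) : R := (dexp i)%:R^-1.

Lemma idexp_gt0 i : 0 < idexp i.
Proof. by rewrite invr_gt0 ltr0n dexp_gt0. Qed.

Lemma idexp_ge0 i : 0 <= idexp i. Proof. exact/ltW/idexp_gt0. Qed.

Lemma ler_idexp i j : (j <= i)%N -> idexp i <= idexp j.
Proof. by move=> ij; rewrite lef_pV2 ?posrE ?ltr0n ?dexp_gt0 // ler_nat leq_dexp. Qed.

Lemma idexpS i : idexp i.+1 = idexp i * idexp i.
Proof. by rewrite /idexp dexpS natrM invfM. Qed.

(** This is why [q] below is [2 ^ h]: an event with [q] factors of equal scale gains [h] scales. *)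
Lemma idexp_expn i j : idexp i ^+ (2 ^ j) = idexp (i + j).
Proof. by rewrite /idexp exprVn -natrX dexp_expn. Qed.

Lemma idexp_absorb (n i j : nat) : (n <= dexp j)%N -> (j < i)%N ->
  n%:R * idexp i <= idexp j.
Proof.
case: i => // i nj; rewrite ltnS => ji; rewrite idexpS mulrA.
apply: le_trans (ler_idexp ji); rewrite ler_piMl ?idexp_ge0 //.
rewrite /idexp ler_pdivrMr ?ltr0n ?dexp_gt0 // mul1r ler_nat.
exact: leq_trans nj (leq_dexp ji).
Qed.

Lemma idexpS_double i : idexp i.+1 + idexp i.+1 <= idexp i.
Proof.
by rewrite -mulr2n -[leLHS]mulr_natl; apply: idexp_absorb => //; apply: dexp_gt1.
Qed.

Lemma idexpS_le4 i : idexp i.+1 <= 4^-1.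
Proof.
rewrite lef_pV2 ?posrE ?ltr0n ?dexp_gt0 // ler_nat dexpS.
by have := dexp_gt1 i; case: dexp => [|[|n]] // _; rewrite mulSn mulnS; lia.
Qed.

End InverseDexp.

(** * Spoilers and their number *)

Section Scales.

Variables (V X : finType) (e : rel V) (own : X -> V) (cf : rel X).
Variables (L : V -> {set X}) (s : V -> nat).

Hypothesis e_sym : symmetric e.
Hypothesis cf_sym : symmetric cf.
Hypothesis cf_e : forall x y, cf x y -> e (own x) (own y).
Hypothesis cf_match : forall x y y', cf x y -> cf x y' -> own y = own y' -> y = y'.
Hypothesis L_own : forall v x, x \in L v -> own x = v.

Hypothesis deg_le : forall v, (#|[set z | e v z]| <= dexp (s v).+1)%N.
Hypothesis L_le : forall v, (#|L v| <= dexp (s v).+1)%N.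

(* Scales count as near if they differ by less than [b] when the first colouring
   is drawn, but by less than [a] when recolouring: the gap ensures that the
   spoilers of [v] have a much larger scale than [v] in either case.  A
   vertex of scale [i] keeps [dexp (i - c)] available colours. *)
Variables (c a b s0 : nat).
Hypothesis a_eq : a = (c + 5)%N.
Hypothesis b_eq : b = (3 * c + 15)%N.
Hypothesis s0_ge : (20 * c + 100 <= s0)%N.
Hypothesis s_ge : forall v, (s0 <= s v)%N.

Definition near (n : nat) (u v : V) : bool := (s u < s v + n)%N && (s v < s u + n)%N.

Lemma near_sym n : symmetric (near n).
Proof. by move=> u v; rewrite /near andbC. Qed.

(* Choosing a spoiler of [v] either takes away the colour of a neighbour of [v]
   (of near scale, hence one that then competes with [v] when recolouring) or
   takes away a colour of [v] itself. *)
Definition spoilers (v : V) : {set X} :=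
  [set y | [exists t, [&& t \in L (own t), e v (own t), near a v (own t),
                          cf t y & (s (own t) + b <= s (own y))%N]]
        || [exists t in L v, cf t y && (s v + a <= s (own y))%N]].

Definition spoilers_at (v : V) (i : nat) : {set X} :=
  [set y in spoilers v | s (own y) == i].

Lemma card_cf x : (#|[set y | cf x y]| <= dexp (s (own x)).+1)%N.
Proof.
apply: leq_trans (deg_le (own x)); rewrite -(@card_in_imset _ _ own).
  by apply: subset_leq_card; apply/subsetP => _ /imsetP[y + ->]; rewrite !inE; apply: cf_e.
by move=> y y'; rewrite !inE => cy cy'; apply: cf_match cy cy'.
Qed.

Let near_part (v : V) : {set X} := \bigcup_(z in [set z | e v z && near a v z])
  \bigcup_(t in L z) [set y | cf t y].

Let own_part (v : V) : {set X} := \bigcup_(t in L v) [set y | cf t y].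

Lemma card_own_part v : (#|own_part v| <= dexp (s v).+2)%N.
Proof.
apply: leq_trans (card_bigcup_le _ _) _.
apply: (@leq_trans (\sum_(t in L v) dexp (s v).+1)).
  by apply: leq_sum => t /L_own <-; apply: card_cf.
by rewrite sum_nat_const [leqRHS]dexpS leq_mul.
Qed.

Lemma card_near_part v : (#|near_part v| <= dexp (s v + a + 2))%N.
Proof.
apply: leq_trans (card_bigcup_le _ _) _.
apply: (@leq_trans (\sum_(z in [set z | e v z && near a v z]) dexp (s v + a + 1))).
  apply: leq_sum => z; rewrite inE => /andP[_ /andP[_ nz]].
  by apply: leq_trans (card_own_part z) _; apply: leq_dexp; lia.
rewrite sum_nat_const; apply: mul_dexp (leqnn _) _ _; last lia.
  apply: leq_trans (deg_le v); apply: subset_leq_card.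
  by apply/subsetP => z; rewrite !inE => /andP[].
lia.
Qed.

Lemma spoilers_sub v : spoilers v \subset near_part v :|: own_part v.
Proof.
apply/subsetP => y; rewrite inE => /orP[/existsP[t /and5P[tL ev nv cty _]]|].
  apply/setUP; left; apply/bigcupP; exists (own t); first by rewrite inE ev.
  by apply/bigcupP; exists t; rewrite ?inE.
move=> /exists_inP[t tL /andP[cty _]]; apply/setUP; right.
by apply/bigcupP; exists t; rewrite ?inE.
Qed.

Lemma card_spoilers v : (#|spoilers v| <= dexp (s v + a + 3))%N.
Proof.
apply: leq_trans (subset_leq_card (spoilers_sub v)) _.
apply: leq_trans (leq_card_setU _ _) _.
by apply: add_dexp (card_near_part v) (card_own_part v) _ _; lia.
Qed.

(** Spoilers through a near neighbour have scale at least [s v + b - a + 1], from where on all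
    spoilers are few compared with [dexp i]. Below, they conflict with a colour of [v] and have
    scale at least [s v + a]. The two cases dictate [b = 2 * a + c + 5] and [a = c + 5]. *)
Lemma card_spoilers_at v i : (#|spoilers_at v i| <= dexp (i - c - 3))%N.
Proof.
case: (leqP (s v + b + 1) (i + a)) => hi.
  apply: (@leq_trans #|spoilers v|).
    by apply: subset_leq_card; apply/subsetP => y; rewrite inE => /andP[].
  by apply: leq_trans (card_spoilers v) _; apply: leq_dexp; lia.
case: (leqP (s v + a) i) => hi'; last first.
  rewrite (_ : spoilers_at v i = set0) ?cards0 //; apply/setP => y.
  rewrite !inE; apply/negP => /andP[hy /eqP o]; case/orP: hy.
    by move=> /existsP[t /and5P[_ _ /andP[n n'] _ st]]; lia.
  by move=> /exists_inP[t _ /andP[_ st]]; lia.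
apply: leq_trans (subset_leq_card (_ : _ \subset own_part v)) _; last first.
  by apply: leq_trans (card_own_part v) _; apply: leq_dexp; lia.
apply/subsetP => y; rewrite inE => /andP[hy /eqP o]; move: hy; rewrite inE => /orP[].
  by move=> /existsP[t /and5P[_ _ /andP[n n'] _ st]]; lia.
move=> /exists_inP[t tL /andP[cty _]].
by apply/bigcupP; exists t; rewrite ?inE.
Qed.

(** Such a [v] is a neighbour of [u] of lower scale or adjacent to one, and lower scale bounds the
    degrees involved in terms of [s u]. *)
Lemma card_spoiled u :
  (#|[set v | [exists y in spoilers v, own y == u]]| <= dexp (s u + 3))%N.
Proof.
pose N v := [set z | e v z].
pose low := [set z in N u | (s z < s u)%N].
apply: (@leq_trans #|low :|: \bigcup_(z in low) N z|).
  apply: subset_leq_card; apply/subsetP => v; rewrite inE => /exists_inP[y].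
  move=> hy /eqP oy; move: hy; rewrite inE => /orP[].
    move=> /existsP[t /and5P[tL ev nv cty st]].
    apply/setUP; right; apply/bigcupP; exists (own t); last by rewrite inE e_sym.
    by rewrite !inE -oy; apply/andP; split; [rewrite e_sym cf_e | lia].
  move=> /exists_inP[t tL /andP[cty st]]; apply/setUP; left.
  by rewrite !inE -oy; apply/andP; split; [rewrite e_sym -(L_own tL) cf_e | lia].
apply: leq_trans (leq_card_setU _ _) _.
have lowle : (#|low| <= dexp (s u).+1)%N.
  apply: leq_trans (deg_le u); apply: subset_leq_card.
  by apply/subsetP => z; rewrite !inE => /andP[].
apply: (@add_dexp _ _ (s u).+1 (s u + 2)) => //; [|lia|lia].
apply: leq_trans (card_bigcup_le _ _) _.
apply: (@leq_trans (\sum_(z in low) dexp (s u).+1)).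
  apply: leq_sum => z; rewrite !inE => /andP[_ sz].
  by apply: leq_trans (deg_le z) _; apply: leq_dexp; lia.
by rewrite sum_nat_const; apply: mul_dexp lowle (leqnn _) _ _; lia.
Qed.

End Scales.

(** * The first colouring *)

Lemma leq_bin_expn n k : ('C(n, k) <= n ^ k)%N.
Proof.
apply: (@leq_trans (n ^_ k)); first by rewrite -bin_ffact leq_pmulr ?fact_gt0.
elim: k n => [//|k IHk] n; rewrite ffactnS expnS leq_mul2l.
by apply/orP; right; apply: leq_trans (IHk _) _; case: (k) => [//|k']; rewrite leq_exp2r ?leq_pred.
Qed.

Lemma subset_of_card (T : finType) (A : {set T}) k : (k <= #|A|)%N ->
  exists2 B : {set T}, B \subset A & #|B| = k.
Proof.
move=> kA; have : (0 < 'C(#|A|, k))%N by rewrite bin_gt0.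
by rewrite -cards_draws => /card_gt0P[B]; rewrite inE => /andP[BA /eqP]; exists B.
Qed.

Section Phase1.

Variable R : realType.
Variables (V X : finType) (e : rel V) (own : X -> V) (cf : rel X).
Variables (L : V -> {set X}) (s : V -> nat).

Hypothesis e_sym : symmetric e.
Hypothesis e_tri : forall x y z, ~~ [&& e x y, e y z & e x z].
Hypothesis cf_sym : symmetric cf.
Hypothesis cf_e : forall x y, cf x y -> e (own x) (own y).
Hypothesis cf_match : forall x y y', cf x y -> cf x y' -> own y = own y' -> y = y'.
Hypothesis L_own : forall v x, x \in L v -> own x = v.

Hypothesis deg_le : forall v, (#|[set z | e v z]| <= dexp (s v).+1)%N.
Hypothesis L_le : forall v, (#|L v| <= dexp (s v).+1)%N.

Variables (c a b h k s0 : nat).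
Hypothesis a_eq : a = (c + 5)%N.
Hypothesis b_eq : b = (3 * c + 15)%N.
Hypothesis h_eq : h = (7 * c + 40)%N.
Hypothesis k_eq : k = (9 * c + 51)%N.
Hypothesis s0_ge : (20 * c + 100 <= s0)%N.
Hypothesis s_ge : forall v, (s0 <= s v)%N.

Local Notation q := (2 ^ h)%N.
Local Notation spoilers := (spoilers e own cf L s a b).
Local Notation spoilers_at := (spoilers_at e own cf L s a b).
Local Notation partials := (partials own cf L (near s b)).
Local Notation avail := (avail own cf L (near s b)).
Local Notation nbr := (nbr e (near s b)).

(** Bounds the probability that all of [Y] is chosen: an owner of scale [i] has [dexp (i - c)]
    available colours, of which [dexp (i - c - 1)] remain after [q] are blocked. The parts that
    menus are drawn from have this same size, so the weight serves both phases. *)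
Definition hit_weight (Y : {set X}) : R := \prod_(y in Y) idexp R (s (own y) - c - 1).

Definition hit_set (vY : V * {set X}) : bool :=
  (#|vY.2| == q) && [exists y in vY.2, vY.2 \subset spoilers_at vY.1 (s (own y))].

Lemma hit_setP vY : hit_set vY -> exists i : nat,
  [/\ #|vY.2| = q, vY.2 \subset spoilers_at vY.1 i,
      forall y, y \in vY.2 -> s (own y) = i & (s0 <= i)%N].
Proof.
move=> /andP[/eqP qY /exists_inP[y0 y0Y sub]]; exists (s (own y0)); split=> //.
by move=> y /(subsetP sub); rewrite inE => /andP[_ /eqP].
Qed.

Lemma hit_weightE vY i : hit_set vY -> (forall y, y \in vY.2 -> s (own y) = i) ->
  hit_weight vY.2 = idexp R (i - c - 1) ^+ q.
Proof.
move=> /andP[/eqP qY _] hs; rewrite /hit_weight (eq_bigr (fun _ => idexp R (i - c - 1))).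
  by rewrite prodr_const qY.
by move=> y /hs ->.
Qed.

(** With [i = s u], each [v] has at most [dexp (i - c - 3) ^ q] sets, of weight
    [idexp (i - c - 1) ^ q] each. The power [q] shifts the surplus by [h] scales, enough for the
    [dexp (i + 3)] choices of [v]. *)
Lemma sum_hit_weight u :
  \sum_(vY | hit_set vY && [exists y in vY.2, own y == u]) hit_weight vY.2 <=
  idexp R (s u - c - 3 + h).
Proof.
set i := s u; have si : (s0 <= i)%N by apply: s_ge.
rewrite (eq_bigr (fun=> idexp R (i - c - 1) ^+ q)); last first.
  move=> vY /andP[hY /exists_inP[y yY /eqP oy]]; apply: hit_weightE => // y' y'Y.
  by have [j [_ _ hj _]] := hit_setP hY; rewrite /i -oy !hj.
pose Vs := [set v | [exists y in spoilers v, own y == u]].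
apply: le_trans (_ : \sum_(v in Vs) \sum_(Y in [set Y : {set X} |
    (Y \subset spoilers_at v i) && (#|Y| == q)]) idexp R (i - c - 1) ^+ q <= _).
  rewrite pair_big_dep /= [leRHS](bigID (fun vY => hit_set vY && [exists y in vY.2, own y == u])) /=.
  rewrite [X in _ <= X + _](eq_bigl (fun vY => hit_set vY && [exists y in vY.2, own y == u])).
    by rewrite lerDl; apply: sumr_ge0 => *; rewrite exprn_ge0 ?idexp_ge0.
  move=> [v Y] /=; apply: andb_idl => /andP[hY /exists_inP[y yY /eqP oy]].
  have [j [qY sub hj _]] := hit_setP hY; have ji : j = i by rewrite /i -oy hj.
  rewrite !inE -ji sub qY eqxx andbT /= andbT; apply/exists_inP; exists y; last by rewrite oy.
  by have := subsetP sub _ yY; rewrite inE => /andP[].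
have inner v : \sum_(Y in [set Y : {set X} |
    (Y \subset spoilers_at v i) && (#|Y| == q)]) idexp R (i - c - 1) ^+ q <=
    idexp R (i - c - 2 + h).
  rewrite sumr_const cards_draws -[leLHS]mulr_natl.
  apply: le_trans (_ : (#|spoilers_at v i| ^ q)%:R * idexp R (i - c - 1) ^+ q <= _).
    by rewrite ler_wpM2r ?exprn_ge0 ?idexp_ge0 // ler_nat leq_bin_expn.
  rewrite natrX -exprMn -idexp_expn; apply: lerXn2r; rewrite ?nnegrE ?mulr_ge0 ?idexp_ge0 //.
  apply: le_trans (idexp_absorb _ (_ : _ <= dexp (i - c - 2))%N _) _ => //; last by lia.
  have : (#|spoilers_at v i| <= dexp (i - c - 3))%N by apply: (@card_spoilers_at _ _ e) => //.
  by move=> /leq_trans; apply; apply: leq_dexp; lia.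
apply: le_trans (ler_sum _ (fun v _ => inner v)) _.
rewrite sumr_const -[leLHS]mulr_natl.
have cV : (#|Vs| <= dexp (s u + 3))%N by apply: (@card_spoiled _ _ e _ _ _ _ _ _ _ _ c a b s0) => //.
apply: le_trans (idexp_absorb _ (_ : _ <= dexp (i - c - 3 + h))%N _) _ => //; last by lia.
by apply: leq_trans cV _; apply: leq_dexp; lia.
Qed.

(** The reasons why a near neighbour of [v] may need recolouring: it has no colour, or a spoiler of
    [v] takes its colour away. *)
Definition labels v : {set option X} := None |: [set Some y | y in spoilers v].

Lemma card_labels v : (#|labels v| <= dexp (s v + a + 4))%N.
Proof.
apply: leq_trans (leq_card_setU _ _) _; rewrite cards1 card_imset; last by move=> ? ? [].
apply: (@add_dexp _ _ 0 (s v + a + 3)); [exact: dexp_gt0| |lia|lia].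
exact: (card_spoilers cf_e cf_match L_own deg_le L_le a_eq b_eq s0_ge v).
Qed.

(** Hit sets are nonempty, so the default 0 is never met on them. *)
Let scale_of (Y : {set X}) : nat := if [pick y in Y] is Some y then s (own y) else 0%N.

Let scale_ofE vY i : hit_set vY -> (forall y, y \in vY.2 -> s (own y) = i) ->
  scale_of vY.2 = i.
Proof.
move=> hY hi; rewrite /scale_of; case: pickP => [y /hi//|h0].
have [_ [qY _ _ _]] := hit_setP hY; move: qY; rewrite (eq_card0 h0) => /esym/eqP.
by rewrite expn_eq0.
Qed.

(** The label threshold [2 ^ (s v + k + 2)] is an exponent of 2: the failure probability becomes
    [idexp (s v + k + 2)], which pays for all colours and labels. *)
Let event (j : V + V * {set X}) : {set {ffun V -> option X}} :=
  match j with
  | inl v => bad_at e own cf L (near s b) (dexp (s v - c)) (2 ^ (s v + k + 2)) (labels v) v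
  | inr vY => hit_event own cf L (near s b) (dexp (scale_of vY.2 - c)) vY.2
  end.

Let valid (j : V + V * {set X}) : bool := if j is inr vY then hit_set vY else true.

Let prob (j : V + V * {set X}) : R :=
  match j with inl v => idexp R (s v + k) | inr vY => hit_weight vY.2 end.

Let resampled (j : V + V * {set X}) : {set V} :=
  match j with inl v => nbr v | inr vY => own @: vY.2 end.

Let domain (j : V + V * {set X}) : {set V} :=
  match j with
  | inl v => event_dom e (near s b) v
  | inr vY => hit_dom e own (near s b) vY.2
  end.

Let card_nbr v : (#|nbr v| <= dexp (s v).+1)%N.
Proof.
apply: leq_trans (deg_le v); apply: subset_leq_card.
by apply/subsetP => z; rewrite !inE => /andP[].
Qed.

Let nbr_scale v w : w \in nbr v -> (s v < s w + b)%N /\ (s w < s v + b)%N.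
Proof. by rewrite inE => /andP[_ /andP[]]. Qed.

Let nbr_symm u v : (u \in nbr v) = (v \in nbr u).
Proof. by rewrite (@nbr_sym _ e (near s b)) //; apply: near_sym. Qed.

(** Two near steps lead less than [2 * b] scales down from [w]; [k], larger than [3 * b], makes up
    for this and for the number of such [v]. *)
Let sum_bad w : \sum_(v | w \in event_dom e (near s b) v) idexp R (s v + k) <=
  idexp R (s w + b + 5).
Proof.
pose A := nbr w :|: \bigcup_(z in nbr w) nbr z.
have sub : [set v | w \in event_dom e (near s b) v] \subset A.
  apply/subsetP => v; rewrite inE => /setUP[wv|/bigcupP[z zv wz]].
    by apply/setUP; left; rewrite nbr_symm.
  apply/setUP; right; apply/bigcupP; exists z; first by rewrite nbr_symm.
  by rewrite nbr_symm.
have cA : (#|A| <= dexp (s w + b + 5))%N.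
  apply: leq_trans (leq_card_setU _ _) _.
  apply: (@add_dexp _ _ (s w).+1 (s w + b + 2)) => //; [|lia|lia].
  apply: leq_trans (card_bigcup_le _ _) _.
  apply: (@leq_trans (\sum_(z in nbr w) dexp (s w + b + 1))).
    apply: leq_sum => z zw; apply: leq_trans (card_nbr z) _; apply: leq_dexp.
    by have [] := nbr_scale zw; lia.
  by rewrite sum_nat_const; apply: mul_dexp (card_nbr w) (leqnn _) _ _; lia.
apply: le_trans (idexp_absorb R cA (_ : _ < s w + b + 6)%N); last by lia.
rewrite mulr_natl -sumr_const.
have le2 v : v \in [set v | w \in event_dom e (near s b) v] ->
    idexp R (s v + k) <= idexp R (s w + b + 6).
  rewrite inE => /setUP[/nbr_scale[]|/bigcupP[z /nbr_scale[? ?] /nbr_scale[]]];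
  move=> *; apply: ler_idexp; lia.
rewrite [leRHS](bigID (fun v => w \in event_dom e (near s b) v)) /=.
apply: le_trans (_ : \sum_(v in A | w \in event_dom e (near s b) v) idexp R (s w + b + 6) <= _).
  rewrite [leRHS](eq_bigl (fun v => w \in event_dom e (near s b) v)); last first.
    by move=> v; apply: andb_idl => wv; apply: (subsetP sub); rewrite inE.
  by apply: ler_sum => v wv; apply: le2; rewrite inE.
by rewrite lerDl; apply: sumr_ge0 => *; rewrite idexp_ge0.
Qed.

(** An owner equal or near to [w] lies less than [b] scales below; [h], larger than [2 * b + c],
    makes up for this. *)
Let sum_hit w : \sum_(vY | hit_set vY && (w \in hit_dom e own (near s b) vY.2)) hit_weight vY.2 <=
  idexp R (s w + b + 5).
Proof.
have sw := s_ge w.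
have w0 vY : 0 <= hit_weight vY.2 by apply: prodr_ge0 => *; rewrite idexp_ge0.
apply: le_trans (_ : \sum_(u in w |: nbr w)
   \sum_(vY | hit_set vY && [exists y in vY.2, own y == u]) hit_weight vY.2 <= _).
  rewrite (exchange_big_dep hit_set) /=; last by move=> ? ? _ /andP[].
  rewrite big_mkcondr; apply: ler_sum => vY hY; case: ifP => [/bigcupP[y yY wy]|_]; last first.
    by apply: sumr_ge0.
  rewrite (bigD1 (own y)) /=.
    by rewrite lerDl; apply: sumr_ge0.
  rewrite hY /=; apply/andP; split; last by apply/exists_inP; exists y.
  by move: wy => /setU1P[->|wy]; rewrite ?setU11 // inE nbr_symm wy orbT.
apply: le_trans (_ : \sum_(u in w |: nbr w) idexp R (s w + b + 6) <= _).
  apply: ler_sum => u uw; apply: le_trans (sum_hit_weight u) _; apply: ler_idexp.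
  by move: uw => /setU1P[->|/nbr_scale[? ?]]; lia.
rewrite sumr_const -[leLHS]mulr_natl; apply: idexp_absorb; last lia.
apply: leq_trans (leq_card_setU _ _) _; rewrite cards1.
by apply: (@add_dexp _ _ 0 (s w).+1); rewrite ?dexp_gt0 ?card_nbr; lia.
Qed.

Let sum_events w : \sum_(j | valid j && (w \in domain j)) prob j <= idexp R (s w + b + 4).
Proof.
rewrite big_sumType /=; apply: le_trans (lerD (sum_bad w) (sum_hit w)) _.
by rewrite !addnS; apply: idexpS_double.
Qed.

(** The analytic input, supplied by [retention_estimate]; [tau] may depend on [v] but not on the
    colouring. *)
Hypothesis retention : forall v, exists tau, forall f, f \in partials ->
  2 ^+ dexp (s v - c) *
  expR (- (2^-1 * (#|[set x in L v | load e own cf L (near s b) R f v x <= tau]|%:R *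
                    expR (- tau)))) <= idexp R (s v + k + 1).

Lemma exists_partial : exists f, [/\ f \in partials,
  forall v, (dexp (s v - c) <= #|avail f v|)%N,
  forall v x lam, x \in avail f v -> lam \in labels v ->
    (label_degree e own cf L (near s b) f v x lam < 2 ^ (s v + k + 2))%N &
  forall v i, (#|[set y in spoilers_at v i | sel own f y]| < q)%N].
Proof.
have prob_ge0 j : 0 <= prob j.
  case: j => [v|vY] /=; first by rewrite idexp_ge0.
  by apply: prodr_ge0 => *; rewrite idexp_ge0.
have nrs := @near_sym V s b.
have [||||||f fP hf] := @local_lemma_ffun R V _ _ partials valid event resampled domain prob.
- apply/set0Pn; exists [ffun=> None]; apply/partialsP; split=> [v x|x y]; first by rewrite ffunE.
  by rewrite /sel ffunE.
- by [].
- move=> [v|vY] /=; first by move=> _; rewrite k_eq !addnS; apply: idexpS_le4.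
  move=> hv; have [i [_ _ hi si]] := hit_setP hv.
  rewrite (hit_weightE hv hi) idexp_expn h_eq !addnS; exact: idexpS_le4.
- move=> [v|vY] f /= hv fP.
    have [tau htau] := retention v.
    apply: (card_bad_at e_tri cf_sym cf_e cf_match L_own nrs (tau := tau)) => //.
    apply: le_trans (idexpS_double R (s v + k)); rewrite -[(s v + k).+1]addn1.
    apply: lerD; first exact: htau.
    rewrite -natrX -/(dexp (s v + k + 2)) -/(idexp R (s v + k + 2)).
    apply: le_trans (idexp_absorb R _ (_ : s v + k + 1 < _)%N) _ => //; last by lia.
    by apply: mul_dexp (L_le v) (card_labels v) _ _; lia.
  have [i [qY _ hi si]] := hit_setP hv; rewrite (hit_weightE hv hi) (scale_ofE hv hi).
  have := card_hit_event e_tri cf_sym cf_e cf_match L_own nrs (dexp (i - c)) vY.2 f.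
  rewrite qY; set n1 := #|_|; set n2 := #|_| => le1.
  have leq1 : (dexp (i - c - 1) <= dexp (i - c) - q)%N.
    have -> : (i - c = (i - c - 1).+1)%N by lia.
    rewrite [X in (_ <= X - _)%N]dexpS (_ : (i - c - 1).+1 - 1 = i - c - 1)%N; last by lia.
    have hq : (q <= dexp (i - c - 1))%N by rewrite /dexp leq_exp2l // ltnW // (leq_trans _ (ltn_expl _ _)) //; lia.
    have h2 := dexp_gt1 (i - c - 1).
    move: hq h2; set d := dexp _; set q' := (2 ^ h)%N; nia.
  have {}le1 : (dexp (i - c - 1) ^ q * n1 <= n2)%N.
    by apply: leq_trans le1; rewrite leq_mul2r leq_exp2r ?expn_gt0 // leq1 orbT.
  rewrite /idexp exprVn -natrX ler_pdivlMl ?ltr0n ?expn_gt0 ?dexp_gt0 //.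
  by rewrite -natrM ler_nat.
- move=> [v|vY] f g hv fP gP /= fg; first exact: bad_at_local fg.
  exact: hit_event_local fg.
- have big4 (A : {set V}) i : (#|A| <= dexp i)%N -> (forall w, w \in A -> (i + 2 <= s w + b + 4)%N) ->
      \sum_(w in A) \sum_(j | valid j && (w \in domain j)) prob j <= 4^-1.
    move=> cA hA; apply: le_trans (_ : \sum_(w in A) idexp R (i + 2) <= _).
      by apply: ler_sum => w wA; apply: le_trans (sum_events w) _; apply/ler_idexp/hA.
    rewrite sumr_const -[leLHS]mulr_natl.
    apply: le_trans (idexp_absorb R (_ : _ <= dexp (i + 1))%N _) _; last by rewrite addn1; apply: idexpS_le4.
      by apply: leq_trans cA _; apply: leq_dexp; lia.
    by lia.
  move=> [v|vY] hv /=.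
    by apply: big4 (card_nbr v) _ => w /nbr_scale[? ?]; lia.
  have [i [qY _ hi si]] := hit_setP hv; apply: (big4 _ h); last by move=> w _; have := s_ge w; lia.
  apply: leq_trans (leq_imset_card _ _) _; rewrite qY /dexp leq_exp2l //.
  exact/ltnW/ltn_expl.
have good v : f \notin bad_at e own cf L (near s b) (dexp (s v - c)) (2 ^ (s v + k + 2)) (labels v) v.
  exact: (hf (inl v)).
have hav v : (dexp (s v - c) <= #|avail f v|)%N.
  by have := good v; rewrite inE negb_or -leqNgt => /andP[].
exists f; split=> // [v x lam xA lamL|v i].
  have := good v; rewrite inE negb_or => /andP[_]; apply: contraR; rewrite -leqNgt => ld.
  by apply/exists_inP; exists x => //; apply/exists_inP; exists lam.
(* Any [q] chosen spoilers of one scale form a hit set, and its event occurs since the owners are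
   known by now to have enough available colours. *)
rewrite ltnNge; apply/negP => /subset_of_card[Y Ysub qY].
have Yi y : y \in Y -> s (own y) = i.
  by move=> /(subsetP Ysub); rewrite !inE => /andP[/andP[_ /eqP]].
have hv : hit_set (v, Y).
  rewrite /hit_set /= qY eqxx /=.
  have [Y0|[y yY]] := set_0Vmem Y.
    by move/eqP: qY; rewrite Y0 cards0 eq_sym expn_eq0.
  apply/exists_inP; exists y => //; rewrite Yi //.
  by apply: subset_trans Ysub _; apply/subsetP => y'; rewrite inE => /andP[].
have := hf (inr (v, Y)) hv => /=; rewrite (scale_ofE hv Yi) inE => /negP; apply.
apply/forall_inP => y yY; rewrite -(Yi y yY) hav andbT.
by have := subsetP Ysub _ yY; rewrite inE => /andP[].
Qed.

End Phase1.

(** * Menus and recolouring *)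

(** The local lemma for independent uniform choices from disjoint parts. The product of the weights
    is the probability that all of [Y i] is chosen if its elements lie in different parts; otherwise
    this cannot happen. *)
Lemma exists_transversal (R : realFieldType) (B X I : finType) (P : B -> {set X})
    (wt : X -> R) (Q : pred I) (Y : I -> {set X}) (r : nat) (tau : R) :
  (forall i, P i != set0) ->
  (forall i j x, x \in P i -> x \in P j -> i = j) ->
  (forall i x, x \in P i -> wt x = #|P i|%:R^-1) ->
  (forall i, Q i -> Y i != set0) ->
  (forall i, Q i -> Y i \subset \bigcup_j P j) ->
  (forall i, Q i -> #|Y i| <= r)%N ->
  (forall j, \sum_(i | Q i && [exists x in Y i, x \in P j]) \prod_(x in Y i) wt x <= tau) ->
  r%:R * tau <= 4^-1 ->
  exists g : {ffun B -> X}, (forall j, g j \in P j) /\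
    forall i, Q i -> exists2 x, x \in Y i & forall j, g j != x.
Proof.
move=> P0 Pinj wtE Y0 YP Yr sumY rtau.
pose p i := \prod_(x in Y i) wt x.
pose W i := [set j | [exists x in Y i, x \in P j]].
pose E i := [set g : {ffun B -> X} | [forall x in Y i, [exists j, g j == x]]].
have p0 i : Q i -> 0 <= p i.
  move=> Qi; rewrite /p; apply: prodr_ge0 => x xY.
  have /bigcupP[j _ xP] := subsetP (YP i Qi) _ xY.
  by rewrite (wtE j) // invr_ge0 ler0n.
have Wr i : Q i -> (#|W i| <= r)%N.
  move=> Qi; apply: leq_trans (Yr i Qi).
  apply: (@leq_trans #|\bigcup_(x in Y i) [set j | x \in P j]|).
    apply: subset_leq_card; apply/subsetP => j; rewrite inE => /exists_inP[x xY xP].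
    by apply/bigcupP; exists x; rewrite ?inE.
  apply: leq_trans (card_bigcup_le _ _) _; rewrite -sum1_card; apply: leq_sum => x xY.
  have /bigcupP[j _ xP] := subsetP (YP i Qi) _ xY.
  rewrite -(cards1 j) subset_leq_card //; apply/subsetP => j'; rewrite !inE => xP'.
  by apply/eqP; apply: Pinj xP' xP.
have r1 i : Q i -> (0 < r)%N.
  by move=> Qi; apply: leq_trans (Yr i Qi); rewrite card_gt0 Y0.
(* The index [j] witnesses that there is a part; without one, [sumY] gives no lower bound on
   [tau]. *)
have tau0 : forall j : B, 0 <= tau.
  by move=> j; apply: le_trans _ (sumY j); apply: sumr_ge0 => i /andP[/p0].
have p4 i : Q i -> p i <= 4^-1.
  move=> Qi; have /set0Pn[x xY] := Y0 i Qi.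
  have /bigcupP[j _ xP] := subsetP (YP i Qi) _ xY.
  apply: le_trans (_ : tau <= _).
    apply: le_trans _ (sumY j); rewrite (bigD1 i) /=.
      by rewrite lerDl; apply: sumr_ge0 => i' /andP[/andP[/p0]].
    by rewrite Qi; apply/exists_inP; exists x.
  by apply: le_trans _ rtau; rewrite ler_peMl ?(tau0 j) // ler1n (r1 i).
have [|//|//|i f Qi fP|i f g Qi fP gP fg|i Qi|g gP gE] :=
  @local_lemma_ffun R B X I (prodset P) Q E W W p.
- have h j : {x | x \in P j} by apply/sigW; have /set0Pn := P0 j.
  apply/set0Pn; exists [ffun j => sval (h j)]; apply/prodsetP => j; rewrite ffunE.
  exact: (svalP (h j)).
- set A := [set g in _ :&: _ | _].
  have [->|[g0]] := set_0Vmem A; first by rewrite cards0 mulr_ge0 ?p0.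
  have AP g : g \in A -> [/\ forall x, x \in Y i -> exists j, g j = x, forall j, g j \in P j &
      forall j, j \notin W i -> g j = f j].
    rewrite inE => /andP[/setIP[]]; rewrite inE => /forall_inP h /prodsetP gP /forall_inP gf.
    split=> // [x /h/existsP[j /eqP <-]|j /gf/eqP//]; by exists j.
  move=> g0A; have [g0Y g0P g0f] := AP _ g0A.
  have onW g : g \in A -> forall j x, x \in Y i -> x \in P j -> g j = x.
    move=> /AP[gY gP _] j x /gY[j' gx] xP; have := gP j'; rewrite gx => xP'.
    by rewrite (Pinj _ _ _ xP xP').
  have -> : A = [set g0].
    apply/setP => g; rewrite in_set1; apply/idP/eqP => [gA|->//].
    apply/ffunP => j; case: (boolP (j \in W i)) => [|jW].
      by rewrite inE => /exists_inP[x xY xP]; rewrite !(onW _ _ j x).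
    by have [_ _ gf] := AP _ gA; rewrite gf // g0f.
  rewrite cards1.
  pose F j := if j \in W i then P j else [set f j].
  have -> : [set g in prodset P | [forall (v | v \notin W i), g v == f v]] = prodset F.
    apply/setP => g; rewrite [LHS]inE; apply/andP/prodsetP => [[/prodsetP gP /forall_inP gf] j|gF].
      by rewrite /F; case: ifPn => // /gf; rewrite inE.
    split; first (apply/prodsetP => j; have := gF j; rewrite /F; case: ifP => // _).
      by rewrite inE => /eqP ->; apply: (prodsetP _ _ fP).
    by apply/forall_inP => j jW; have := gF j; rewrite /F (negbTE jW) inE.
  have YE : Y i = g0 @: W i.
    apply/setP => x; apply/idP/imsetP => [xY|[j + ->]].
      have [j gx] := g0Y _ xY; exists j => //; rewrite inE; apply/exists_inP; exists x => //.
      by rewrite -gx.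
    by rewrite inE => /exists_inP[x' x'Y x'P]; rewrite (onW _ g0A j x').
  rewrite card_prodset natr_prod /p YE big_imset /=; last first.
    by move=> j j' _ _ gg; apply: (Pinj _ _ (g0 j)); rewrite // gg.
  rewrite [X in _ * X](bigID (mem (W i))) /= [X in _ * (_ * X)]big1 ?mulr1.
    rewrite -big_split /= big1 // => j jW; rewrite /F jW (wtE j) // mulVf // pnatr_eq0.
    by rewrite cards_eq0.
  by move=> j jW; rewrite /F (negbTE jW) cards1.
- rewrite [LHS]inE [RHS]inE; apply: eq_forallb => x; case xY: (x \in Y i) => //=.
  have /bigcupP[j _ xP] := subsetP (YP i Qi) _ xY.
  have jW : j \in W i by rewrite inE; apply/exists_inP; exists x.
  have one (g1 : {ffun B -> X}) : g1 \in prodset P -> [exists j, g1 j == x] = (g1 j == x).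
    move=> /prodsetP g1P; apply/idP/idP => [/existsP[j' /eqP gx]|gx]; last first.
      by apply/existsP; exists j.
    by have := g1P j'; rewrite gx => /(Pinj _ _ _ xP) ->; rewrite gx.
  by rewrite !one // fg.
- apply: le_trans (_ : \sum_(w in W i) tau <= _).
    apply: ler_sum => j _; apply: le_trans _ (sumY j).
    by rewrite le_eqVlt; apply/orP; left; apply/eqP; apply: eq_bigl => i'; rewrite inE.
  rewrite sumr_const -[leLHS]mulr_natl; apply: le_trans _ rtau.
  have /set0Pn[x xY] := Y0 i Qi.
  have /bigcupP[j _ _] := subsetP (YP i Qi) _ xY.
  by rewrite ler_wpM2r ?(tau0 j) // ler_nat Wr.
exists g; split; first exact/prodsetP.
move=> i /gE; rewrite inE negb_forall => /existsP[x]; rewrite negb_imply => /andP[xY].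
by rewrite negb_exists => /forallP h; exists x.
Qed.

Lemma exists_parts (T : finType) (A : {set T}) (m l : nat) : (m * l <= #|A|)%N ->
  exists P : {ffun 'I_m -> {set T}}, [/\ forall i, P i \subset A, forall i, #|P i| = l &
    forall i j x, x \in P i -> x \in P j -> i = j].
Proof.
elim: m A => [|m IHm] A mA; first by exists [ffun=> set0]; split=> -[].
have [B BA cB] : exists2 B : {set T}, B \subset A & #|B| = l.
  by apply: subset_of_card; apply: leq_trans mA; rewrite mulSn leq_addr.
have [P [PA cP Pinj]] : exists P : {ffun 'I_m -> {set T}}, [/\ forall i, P i \subset A :\: B,
    forall i, #|P i| = l & forall i j x, x \in P i -> x \in P j -> i = j].
  by apply: IHm; rewrite cardsD (setIidPr BA) cB; move: mA; rewrite mulSn; lia.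
exists [ffun i => if unlift ord0 i is Some j then P j else B]; split.
- move=> i; rewrite ffunE; case: unliftP => [j _|_] //.
  by apply: subset_trans (PA j) (subsetDl _ _).
- by move=> i; rewrite ffunE; case: unliftP => [j _|_].
move=> i j x; rewrite !ffunE.
case: unliftP => [i' ->|->]; case: unliftP => [j' ->|->] // xi xj.
- by rewrite (Pinj _ _ _ xi xj).
- by have := subsetP (PA i') _ xi; rewrite inE xj.
by have := subsetP (PA j') _ xj; rewrite inE xi.
Qed.

Section Phase2.

Variable R : realType.
Variables (V X : finType) (e : rel V) (own : X -> V) (cf : rel X).
Variables (L : V -> {set X}) (s : V -> nat).

Hypothesis e_sym : symmetric e.
Hypothesis e_tri : forall x y z, ~~ [&& e x y, e y z & e x z].
Hypothesis cf_sym : symmetric cf.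
Hypothesis cf_e : forall x y, cf x y -> e (own x) (own y).
Hypothesis cf_match : forall x y y', cf x y -> cf x y' -> own y = own y' -> y = y'.
Hypothesis L_own : forall v x, x \in L v -> own x = v.

Hypothesis deg_le : forall v, (#|[set z | e v z]| <= dexp (s v).+1)%N.
Hypothesis L_le : forall v, (#|L v| <= dexp (s v).+1)%N.

Variables (c a b h k s0 : nat).
Hypothesis a_eq : a = (c + 5)%N.
Hypothesis b_eq : b = (3 * c + 15)%N.
Hypothesis h_eq : h = (7 * c + 40)%N.
Hypothesis k_eq : k = (9 * c + 51)%N.
Hypothesis s0_ge : (20 * c + 100 <= s0)%N.
Hypothesis s_ge : forall v, (s0 <= s v)%N.

Local Notation q := (2 ^ h)%N.
Local Notation spoilers := (spoilers e own cf L s a b).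
Local Notation spoilers_at := (spoilers_at e own cf L s a b).
Local Notation partials := (partials own cf L (near s b)).
Local Notation avail := (avail own cf L (near s b)).
Local Notation nbr := (nbr e (near s b)).
Local Notation labels := (labels e own cf L s a b).
Local Notation hit_set := (hit_set e own cf L s a b h).
Local Notation hit_weight := (hit_weight R own s c).

Variables (S m : nat).
Hypothesis s_lt : forall v, (s v < S)%N.
Hypothesis m_theta : forall v, (m * 2 ^ (s v + k + 2) <= dexp (s v - a - c - 3))%N.
Hypothesis m_parts : forall v, (m * dexp (s v - c - 1) + q * S <= dexp (s v - c))%N.
Hypothesis m_big : ((1 + 2 * q * S) * q + q * S < m)%N.

Variable f : {ffun V -> option X}.
Hypothesis fP : f \in partials.
Hypothesis f_avail : forall v, (dexp (s v - c) <= #|avail f v|)%N.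
Hypothesis f_label : forall v x lam, x \in avail f v -> lam \in labels v ->
    (label_degree e own cf L (near s b) f v x lam < 2 ^ (s v + k + 2))%N.
Hypothesis f_hit : forall v i, (#|[set y in spoilers_at v i | sel own f y]| < q)%N.

(* The colours of [v] in conflict with no coloured neighbour of near or larger
   degree; smaller-degree neighbours will have to give way to [v]. *)
Definition menu_base v : {set X} :=
  [set x in L v | [forall y, sel own f y && cf x y ==> (s (own y) + b <= s v)%N]].

Lemma menu_base_avail v : menu_base v \subset avail f v.
Proof.
apply/subsetP => x; rewrite inE => /andP[xL /forallP hx]; apply/availP; split=> // y sy cxy.
have := hx y; rewrite sy cxy /= /near => h1; apply/negP => /andP[h2 h3]; lia.
Qed.

(** Available colours are lost to chosen colours at neighbours at least [b] scales up. These are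
    spoilers, fewer than [q] per scale, and each takes one colour; [m_parts] provides for [q * S]
    losses. *)
Lemma card_menu_base v : (m * dexp (s v - c - 1) <= #|menu_base v|)%N.
Proof.
pose lost (i : 'I_S) := [set x in L v |
  [exists y in [set y in spoilers_at v i | sel own f y], cf x y]].
have sub : avail f v \subset menu_base v :|: \bigcup_i lost i.
  apply/subsetP => x /availP[xL hx]; apply/setUP.
  have [xM|] := boolP (x \in menu_base v); [by left | move=> xM; right].
  move: xM; rewrite inE xL negb_forall => /existsP[y].
  rewrite negb_imply => /andP[/andP[sy cxy]]; rewrite -ltnNge => lt1.
  have n1 := hx y sy cxy.
  have le1 : (s v + b <= s (own y))%N by move: n1; rewrite /near; lia.
  apply/bigcupP; exists (Ordinal (s_lt (own y))) => //; rewrite inE xL /=.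
  apply/exists_inP; exists y => //; rewrite !inE sy eqxx !andbT; apply/orP; right.
  by apply/exists_inP; exists x => //; rewrite cxy; lia.
have := leq_trans (f_avail v) (subset_leq_card sub).
move=> /leq_trans/(_ (leq_card_setU _ _)) le1.
have le2 : (#|\bigcup_i lost i| <= q * S)%N.
  apply: leq_trans (card_bigcup_le _ _) _.
  apply: (@leq_trans (\sum_(i < S) q)); last by rewrite sum_nat_const card_ord mulnC.
  apply: leq_sum => i _; apply: leq_trans (ltnW (f_hit v i)).
  by apply: (card_matched cf_sym cf_match) => x; apply: L_own.
by have := m_parts v; lia.
Qed.

(** Each vertex draws one colour from each of [m] parts of its menu base, and [T] collects all
    menus. The local lemma excludes [q] spoilers of [v] of one scale in [T], and [q] menu colours of
    [v] in conflict with menus of near neighbours carrying the same label. *)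
Lemma exists_menus : exists T : {set X}, [/\
  {in T, forall x, x \in menu_base (own x)},
  forall v, (m <= #|[set x in T | own x == v]|)%N,
  forall v i, (#|[set y in spoilers_at v i | y \in T]| < q)%N &
  forall v lam, lam \in labels v ->
    (#|[set x in T | (own x == v) && [exists y in T,
        [&& cf x y, near s a v (own y) & labelled cf lam (f (own y))]]]| < q)%N].
Proof.
have /fin_all_exists[P hP] v := exists_parts (card_menu_base v).
pose PP (vi : V * 'I_m) := P vi.1 vi.2.
have PPsub vi x : x \in PP vi -> x \in menu_base vi.1.
  by have [h1 _ _] := hP vi.1; apply: (subsetP (h1 vi.2)).
have PPown vi x : x \in PP vi -> own x = vi.1.
  by move=> /PPsub/(subsetP (menu_base_avail _))/avail_L/L_own.
have PPinj vi wj x : x \in PP vi -> x \in PP wj -> vi = wj.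
  case: vi wj => [v i] [w j] xi xj; have := PPown _ _ xi; rewrite (PPown _ _ xj) /= => vw.
  by rewrite vw in xj *; have [_ _ h1] := hP v; rewrite (h1 i j x).
have PPcard vi : #|PP vi| = dexp (s vi.1 - c - 1).
  by have [_ h1 _] := hP vi.1; apply: h1.
pose PS v := \bigcup_i PP (v, i).
have PSsub v x : x \in PS v -> x \in menu_base v by move=> /bigcupP[i _ /PPsub].
have PSown v x : x \in PS v -> own x = v by move=> /bigcupP[i _ /PPown].
have PScard v : (#|PS v| <= m * dexp (s v - c - 1))%N.
  apply: leq_trans (card_bigcup_le _ _) _.
  by rewrite (eq_bigr (fun=> dexp (s v - c - 1))) ?sum_nat_const ?card_ord // => i _; rewrite PPcard.
pose wt x : R := idexp R (s (own x) - c - 1).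
(* Events of the second kind are recorded by [q] conflicting pairs with distinct first entries; the
   second entries are then distinct by the matching condition, so [2 * q] colours are involved. *)
pose Pair v lam := [set xy : X * X | [&& xy.1 \in PS v, xy.2 \in PS (own xy.2),
   near s a v (own xy.2), labelled cf lam (f (own xy.2)) & cf xy.1 xy.2]].
pose ok (j : (V * {set X}) + (V * (option X * {set X * X}))) : bool :=
  match j with
  | inl vY => hit_set vY && (vY.2 \subset \bigcup_j PP j)
  | inr (v, (lam, Pr)) => [&& lam \in labels v, Pr \subset Pair v lam, #|Pr| == q &
                             #|[set p.1 | p in Pr]| == q]
  end.
pose Y (j : (V * {set X}) + (V * (option X * {set X * X}))) : {set X} :=
  match j with
  | inl vY => vY.2
  | inr (_, (_, Pr)) => [set p.1 | p in Pr] :|: [set p.2 | p in Pr]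
  end.
have e_irr v : e v v = false by have := e_tri v v v; case: (e v v).
have PairP v lam p : p \in Pair v lam -> [/\ p.1 \in PS v, p.2 \in PS (own p.2),
   near s a v (own p.2), labelled cf lam (f (own p.2)) & cf p.1 p.2].
  by rewrite inE => /and5P.
have card_Pair v lam : lam \in labels v ->
    (#|Pair v lam| <= m * dexp (s v - c - 1) * 2 ^ (s v + k + 2))%N.
  move=> lamL; apply: (@leq_trans #|\bigcup_(x in PS v) [set (x, y) | y in [set y | (x, y) \in Pair v lam]]|).
    apply: subset_leq_card; apply/subsetP => -[x y] xy; have [/= xP _ _ _ _] := PairP _ _ _ xy.
    by apply/bigcupP; exists x => //; apply: imset_f; rewrite in_set.
  apply: leq_trans (card_bigcup_le _ _) _.
  apply: (@leq_trans (\sum_(x in PS v) 2 ^ (s v + k + 2))); last first.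
    by rewrite sum_nat_const leq_mul.
  apply: leq_sum => x xP; rewrite card_imset; last by move=> ? ? [].
  have xA := subsetP (menu_base_avail v) _ (PSsub _ _ xP).
  apply: leq_trans (ltnW (f_label xA lamL)).
  rewrite -(@card_in_imset _ _ own).
    apply: subset_leq_card; apply/subsetP => _ /imsetP[y + ->].
    rewrite in_set => /PairP[/= _ yP nv lv cxy]; rewrite inE lv /=; apply/andP; split.
      by rewrite inE -{1}(PSown _ _ xP) cf_e //=; move: nv; rewrite /near; lia.
    by apply/exists_inP; exists y => //; apply/(subsetP (menu_base_avail _))/PSsub.
  move=> y y'; rewrite !in_set => /and5P[_ _ _ _ /= c1] /and5P[_ _ _ _ /= c2].
  exact: cf_match c1 c2.
have sndinj v lam (Pr : {set X * X}) : Pr \subset Pair v lam -> {in Pr &, injective snd}.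
  move=> sub [x y] [x' y'] /(subsetP sub)/PairP[/= xP _ _ _ cxy].
  move=> /(subsetP sub)/PairP[/= xP' _ _ _ cxy'] yy; rewrite -yy in cxy' *; congr (_, _).
  by apply: (@cf_match y); rewrite ?(cf_sym y) // (PSown _ _ xP) (PSown _ _ xP').
have wt_inr v lam Pr : ok (inr (v, (lam, Pr))) -> \prod_(x in Y (inr (v, (lam, Pr)))) wt x <=
    (idexp R (s v - c - 1) * idexp R (s v - a - c - 1)) ^+ q.
  move=> /and4P[lamL sub /eqP cP /eqP c1]; rewrite /Y.
  have c2 : #|[set p.2 | p in Pr]| = q by rewrite card_in_imset //; apply: sndinj sub.
  rewrite (big_setID [set p.1 | p in Pr]) /= setUK (_ : _ :\: _ = [set p.2 | p in Pr]); last first.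
    rewrite setDUl setDv set0U; apply/setDidPl; rewrite disjoint_sym; apply/pred0P => x /=.
    apply/negP => /andP[/imsetP[p /(subsetP sub)/PairP[pP _ _ _ _] xp]].
    move=> /imsetP[p' /(subsetP sub)/PairP[pP' _ _ _ cp'] xp'].
    by have := cf_e cp'; rewrite -xp' xp (PSown _ _ pP) (PSown _ _ pP') e_irr.
  rewrite exprMn; apply: ler_pM.
  - by apply: prodr_ge0 => *; apply: idexp_ge0.
  - by apply: prodr_ge0 => *; apply: idexp_ge0.
  - rewrite -[X in _ ^+ X]c1 -prodr_const; apply: ler_prod => x /imsetP[p /(subsetP sub)/PairP[pP _ _ _ _] ->].
    by rewrite /wt idexp_ge0 (PSown _ _ pP) lexx.
  rewrite -[X in _ ^+ X]c2 -prodr_const; apply: ler_prod => x /imsetP[p /(subsetP sub)/PairP[_ _ nv _ _] ->].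
  by rewrite /wt idexp_ge0 /=; apply: ler_idexp; move: nv; rewrite /near; lia.
have sum_near v : \sum_(lamPr | ok (inr (v, lamPr))) \prod_(x in Y (inr (v, lamPr))) wt x <=
    idexp R (s v - a - c - 3 + h).
  have sv := s_ge v.
  set w := idexp R (s v - c - 1) * idexp R (s v - a - c - 1) in wt_inr *.
  have w0 : 0 <= w by rewrite /w mulr_ge0 ?idexp_ge0.
  apply: le_trans (_ : \sum_(lam in labels v) \sum_(Pr in [set Pr : {set X * X} |
      (Pr \subset Pair v lam) && (#|Pr| == q)]) w ^+ q <= _).
    rewrite pair_big_dep.
    apply: le_trans (_ : \sum_(lamPr | ok (inr (v, lamPr))) w ^+ q <= _).
      by apply: ler_sum => -[lam Pr] okj; apply: (wt_inr v lam Pr okj).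
    apply: ler_sum_subpred => [[lam Pr] /and4P[lamL sub cP _]|*]; last by rewrite exprn_ge0.
    by rewrite lamL in_set sub cP.
  have inner lam : lam \in labels v -> \sum_(Pr in [set Pr : {set X * X} |
      (Pr \subset Pair v lam) && (#|Pr| == q)]) w ^+ q <= idexp R (s v - a - c - 2 + h).
    move=> lamL; rewrite sumr_const cards_draws -[leLHS]mulr_natl.
    apply: le_trans (_ : (#|Pair v lam| ^ q)%:R * w ^+ q <= _).
      by rewrite ler_wpM2r ?exprn_ge0 // ler_nat leq_bin_expn.
    rewrite natrX -exprMn -idexp_expn; apply: lerXn2r; rewrite ?nnegrE ?mulr_ge0 ?idexp_ge0 //.
    apply: le_trans (_ : (m * dexp (s v - c - 1) * 2 ^ (s v + k + 2))%:R * w <= _).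
      by rewrite ler_wpM2r // ler_nat card_Pair.
    (* The part size in the number of pairs cancels with the weight of the first entry; what is left
       is outweighed by that of the second, by [m_theta]. *)
    have -> : (m * dexp (s v - c - 1) * 2 ^ (s v + k + 2))%:R * w =
        (m * 2 ^ (s v + k + 2))%:R * idexp R (s v - a - c - 1).
      have d0 : (dexp (s v - c - 1))%:R != 0 :> R by rewrite pnatr_eq0 -lt0n dexp_gt0.
      by rewrite /w mulnAC natrM mulrA -[X in X * _ = _]mulrA /idexp mulfV ?mulr1.
    apply: idexp_absorb; last lia.
    by apply: leq_trans (m_theta v) _; apply: leq_dexp; lia.
  apply: le_trans (ler_sum _ inner) _; rewrite sumr_const -[leLHS]mulr_natl.
  apply: le_trans (idexp_absorb R (_ : _ <= dexp (s v - a - c - 3 + h))%N _) _ => //; last by lia.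
  apply: leq_trans (card_labels cf_e cf_match L_own deg_le L_le a_eq b_eq h_eq k_eq s0_ge v) _.
  by apply: leq_dexp; lia.
have wt0 i : 0 <= \prod_(x in Y i) wt x by apply: prodr_ge0 => *; apply: idexp_ge0.
have sum_le (j : V * 'I_m) : \sum_(i | ok i && [exists x in Y i, x \in PP j])
    \prod_(x in Y i) wt x <= idexp R (h + 3).
  case: j => u j; have su := s_ge u; rewrite big_sumType /= addnS.
  apply: le_trans (idexpS_double R _); apply: lerD.
    apply: le_trans (_ : idexp R (s u - c - 3 + h) <= _); last by apply: ler_idexp; lia.
    apply: le_trans (sum_hit_weight R e_sym cf_e cf_match L_own deg_le L_le a_eq b_eq h_eq k_eq s0_ge s_ge u).
    apply: (@ler_sum_subpred R) => [vY /andP[/andP[-> _] /exists_inP[x xY xP]]|vY _].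
      by apply/exists_inP; exists x => //; rewrite (PPown _ _ xP).
    exact: (wt0 (inl vY)).
  pose NB := u |: [set z | e u z && near s a u z].
  have cNB : (#|NB| <= dexp (s u + 2))%N.
    apply: leq_trans (leq_card_setU _ _) _; rewrite cards1.
    apply: (@add_dexp _ _ 0 (s u).+1); rewrite ?dexp_gt0 //; [|lia|lia].
    apply: leq_trans (deg_le u); apply: subset_leq_card.
    by apply/subsetP => z; rewrite !inE => /andP[].
  apply: le_trans (_ : \sum_(v in NB) idexp R (s u + h - 2 * a - c - 3) <= _); last first.
    rewrite sumr_const -[leLHS]mulr_natl.
    apply: le_trans (idexp_absorb R (_ : _ <= dexp (s u + h - 2 * a - c - 4))%N _) _; last by apply: ler_idexp; lia.
      by apply: leq_trans cNB _; apply: leq_dexp; lia.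
    by lia.
  apply: le_trans (_ : \sum_(v in NB) \sum_(lamPr | ok (inr (v, lamPr)))
      \prod_(x in Y (inr (v, lamPr))) wt x <= _); last first.
    apply: ler_sum => v vN; apply: le_trans (sum_near v) _; apply: ler_idexp.
    have sv := s_ge v.
    by move: vN => /setU1P[->|]; [|rewrite inE => /andP[_]; rewrite /near]; lia.
  rewrite pair_big_dep; rewrite [leRHS](eq_bigr (fun p => \prod_(x in Y (inr p)) wt x)); last by case.
  apply: (@ler_sum_subpred R) => [[v [lam Pr]] /andP[okj /exists_inP[x xY /PPown/= ox]]|p _]; last first.
    exact: (wt0 (inr p)).
  rewrite okj andbT; move: okj => /and4P[/= _ sub _ _]; apply/setU1P.
  move: xY => /setUP[] /imsetP[p /(subsetP sub)/PairP[pP _ nv _ cp] xp].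
    by left; rewrite -ox xp (PSown _ _ pP).
  right; rewrite inE -ox xp near_sym nv andbT e_sym.
  by have := cf_e cp; rewrite (PSown _ _ pP).
have qpos : (0 < q)%N by rewrite expn_gt0.
have PSin v x : x \in menu_base v -> own x = v by move=> /(subsetP (menu_base_avail _))/avail_L/L_own.
have [|||||||g [gP gY]] := @exists_transversal R _ _ _ PP wt ok Y (2 * q) (idexp R (h + 3)) _ _ _ _ _ _ sum_le.
- by move=> vi; rewrite -card_gt0 PPcard dexp_gt0.
- exact: PPinj.
- by move=> vi x xP; rewrite PPcard /wt (PPown _ _ xP).
- move=> [vY|[v [lam Pr]]] okj; rewrite -card_gt0.
    by move: okj => /andP[/andP[/eqP cY _] _]; rewrite [Y _]/(vY.2) cY.
  move: okj => /and4P[_ _ _ /eqP c1]; rewrite /Y; apply: leq_trans (subset_leq_card (subsetUl _ _)).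
  by rewrite c1.
- move=> [vY|[v [lam Pr]]] okj; first by move: okj => /andP[].
  move: okj => /and4P[_ sub _ _]; apply/subsetP => x /setUP[] /imsetP[p /(subsetP sub)/PairP[p1 p2 _ _ _] ->].
    by have /bigcupP[i _ xi] := p1; apply/bigcupP; exists (v, i).
  by have /bigcupP[i _ xi] := p2; apply/bigcupP; exists (own p.2, i).
- move=> [vY|[v [lam Pr]]] okj.
    by move: okj => /andP[/andP[/eqP cY _] _]; rewrite [Y _]/(vY.2) cY mul2n -addnn leq_addr.
  move: okj => /and4P[_ _ /eqP cP _]; rewrite /Y; apply: leq_trans (leq_card_setU _ _) _.
  by rewrite mul2n -addnn leq_add // -[leqRHS]cP leq_imset_card.
- apply: le_trans (idexp_absorb R (_ : _ <= dexp (h + 2))%N _) _; [|lia|].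
    rewrite -expnS /dexp leq_exp2l //; apply: leq_trans (ltnW (ltn_expl _ (ltnSn 1))) _.
    by rewrite leq_exp2l //; lia.
  by rewrite addn2; apply: idexpS_le4.
pose T := [set g j | j : V * 'I_m].
have TP x : x \in T -> exists2 j, x = g j & x \in PP j.
  by move=> /imsetP[j _ ->]; exists j.
have TPS x : x \in T -> x \in PS (own x).
  by move=> /TP[[v i] _ xP]; rewrite (PPown _ _ xP); apply/bigcupP; exists i.
have noY j : ok j -> ~ (Y j \subset T).
  move=> /gY[x xY gx] /subsetP/(_ x xY)/imsetP[j' _ xj].
  by have := gx j'; rewrite xj eqxx.
exists T; split.
- by move=> x /TPS/PSsub.
- move=> v; have -> : m = #|[set g (v, i) | i : 'I_m]|.
    rewrite card_imset ?card_ord // => i i' gg.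
    have := gP (v, i'); rewrite -gg => gP'.
    by case: (PPinj _ _ _ (gP (v, i)) gP').
  apply: subset_leq_card; apply/subsetP => _ /imsetP[i _ ->].
  by rewrite inE imset_f //= (PPown _ _ (gP (v, i))).
- move=> v i; rewrite ltnNge; apply/negP => /subset_of_card[Y0 Ysub cY].
  have YT : Y0 \subset T by apply: subset_trans Ysub _; apply/subsetP => y; rewrite inE => /andP[].
  apply: (noY (inl (v, Y0))); last exact: YT.
  apply/andP; split; last first.
    apply/subsetP => y yY; have [j _ yP] := TP _ (subsetP YT _ yY).
    by apply/bigcupP; exists j.
  rewrite /hit_set /= cY eqxx /=; have /card_gt0P[y yY] : (0 < #|Y0|)%N by rewrite cY.
  apply/exists_inP; exists y => //; apply: (subset_trans Ysub); apply/subsetP => y'.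
  rewrite inE => /andP[y'S _].
  have := subsetP Ysub _ yY; rewrite !inE => /andP[/andP[_ /eqP ->] _].
  by move: y'S; rewrite !inE.
move=> v lam lamL; rewrite ltnNge; apply/negP => /subset_of_card[Xs Xsub cX].
pose good x := [pred y in T | [&& cf x y, near s a v (own y) & labelled cf lam (f (own y))]].
(* The default is not reached on [Xs]. Pairing each colour with its witness gives a forbidden set of
   pairs. *)
pose ch x := odflt x [pick y in good x].
have XsP x : x \in Xs -> [/\ x \in T, own x = v, ch x \in T & ch x \in good x].
  move=> /(subsetP Xsub); rewrite inE => /and3P[xT /eqP ox /exists_inP[y yT hy]].
  rewrite /ch; case: pickP => [y' y'g|/(_ y)]; last by rewrite !inE yT hy.
  by split=> //; move: (y'g); rewrite !inE => /andP[].
pose Pr := [set (x, ch x) | x in Xs].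
have cPr : #|Pr| = q by rewrite card_imset // => x x' [].
have fPr : [set p.1 | p in Pr] = Xs.
  apply/setP => x; apply/imsetP/idP => [[p /imsetP[x' x'X ->] ->]//|xX].
  by exists (x, ch x) => //; apply: imset_f.
apply: (noY (inr (v, (lam, Pr)))).
  apply/and4P; split; rewrite ?cPr ?fPr ?cX //.
  apply/subsetP => _ /imsetP[x /XsP[xT ox cT cg] ->]; rewrite inE /= -{1}ox TPS // TPS //=.
  by move: cg; rewrite !inE => /and4P[_ -> -> ->].
apply/subsetP => x /setUP[].
  by rewrite fPr => /XsP[].
by move=> /imsetP[p /imsetP[x' /XsP[_ _ cT _] ->] ->].
Qed.

(** The [active] vertices take a menu colour that is not [bad]. The labels that occur are [None] and
    the spoilers chosen or on menus, at most [1 + 2 * q * S]; each rules out fewer than [q] menu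
    colours, as do the much larger neighbours of each scale. [m_big] leaves a colour. *)
Lemma exists_colouring :
  exists col : V -> X, (forall v, col v \in L v) /\ forall u v, ~~ cf (col u) (col v).
Proof.
have [T [TM Tm Th Tn]] := exists_menus.
have [fL fC] := partialsP _ _ _ _ _ fP.
pose active v := if f v is Some t then
  [exists y, [&& sel own f y || (y \in T), cf t y & (s v + b <= s (own y))%N]] else true.
pose bad v x := [exists y in T, cf x y &&
  ((near s a v (own y) && active (own y)) || (s v + a <= s (own y))%N)].
have TL x : x \in T -> x \in L (own x).
  by move=> /TM/(subsetP (menu_base_avail _))/avail_L.
have free v : exists x, [/\ x \in T, own x = v & ~~ bad v x].
  pose M := [set x in T | own x == v].
  pose Lab := None |: [set Some y | y in
     \bigcup_(i < S) ([set y in spoilers_at v i | sel own f y] :|: [set y in spoilers_at v i | y \in T])].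
  pose Lab' := Lab :&: labels v.
  pose N lam := [set x in T | (own x == v) && [exists y in T,
        [&& cf x y, near s a v (own y) & labelled cf lam (f (own y))]]].
  pose F (i : 'I_S) := [set x in M | [exists y in [set y in spoilers_at v i | y \in T], cf x y]].
  have cLab : (#|Lab'| <= 1 + 2 * q * S)%N.
    apply: leq_trans (subset_leq_card (subsetIl _ _)) _.
    apply: leq_trans (leq_card_setU _ _) _; rewrite cards1 leq_add2l.
    apply: leq_trans (leq_imset_card _ _) _; apply: leq_trans (card_bigcup_le _ _) _.
    apply: (@leq_trans (\sum_(i < S) (2 * q))%N); last by rewrite sum_nat_const card_ord mulnC.
    apply: leq_sum => i _; apply: leq_trans (leq_card_setU _ _) _.
    by rewrite mul2n -addnn leq_add // ltnW.
  pose Bad := \bigcup_(lam in Lab') N lam :|: \bigcup_i F i.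
  have cBad : (#|Bad| < m)%N.
    apply: leq_ltn_trans m_big; apply: leq_trans (leq_card_setU _ _) _; apply: leq_add.
      apply: leq_trans (card_bigcup_le _ _) _.
      apply: (@leq_trans (\sum_(lam in Lab') q)); last by rewrite sum_nat_const leq_mul.
      by apply: leq_sum => lam /setIP[_ /Tn]; apply: ltnW.
    apply: leq_trans (card_bigcup_le _ _) _.
    apply: (@leq_trans (\sum_(i < S) q)); last by rewrite sum_nat_const card_ord mulnC.
    apply: leq_sum => i _; apply: leq_trans (ltnW (Th v i)).
    by apply: (card_matched cf_sym cf_match) => x; rewrite inE => /andP[_ /eqP]; apply.
  have sub : [set x in M | bad v x] \subset Bad.
    apply/subsetP => x; rewrite inE => /andP[]; rewrite inE => /andP[xT /eqP ox].
    move=> /exists_inP[y yT /andP[cxy /orP[/andP[nv acty]|sy]]]; apply/setUP; last first.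
      right; apply/bigcupP; exists (Ordinal (s_lt (own y))) => //.
      rewrite !inE xT ox eqxx /=; apply/exists_inP; exists y => //.
      rewrite !inE yT eqxx !andbT; apply/orP; right; apply/exists_inP; exists x; last by rewrite cxy.
      by rewrite -ox TL.
    (* An active near neighbour carries a label that occurs: [None], or the spoiler that takes its
       colour away. *)
    left; suff [lam lamL' lab] : exists2 lam, lam \in Lab' & labelled cf lam (f (own y)).
      by apply/bigcupP; exists lam => //; rewrite inE xT ox eqxx /=; apply/exists_inP; exists y => //; rewrite cxy nv.
    move: acty; rewrite /active; case fy: (f (own y)) => [t|]; last by exists None; rewrite // in_setI !setU11.
    have [ot _] := partials_sel L_own fP fy.
    move=> /existsP[y' /and3P[hy' cty' sy']]; exists (Some y') => //.
    have y'S : y' \in spoilers v.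
      rewrite inE; apply/orP; left; apply/existsP; exists t; rewrite ot.
      by rewrite (fL _ _ fy) -ox cf_e // ox nv cty'.
    have y'i : y' \in spoilers_at v (s (own y')) by rewrite inE y'S eqxx.
    apply/setIP; split; apply/setU1P; right; apply: imset_f => //.
    apply/bigcupP; exists (Ordinal (s_lt (own y'))) => //; apply/setUP.
    by move: hy' => /orP[h1|h1]; [left | right]; rewrite in_set h1 andbT.
  have : (0 < #|M :\: Bad|)%N.
    rewrite cardsD subn_gt0; apply: leq_trans (Tm v).
    by apply: leq_ltn_trans cBad; apply: subset_leq_card; apply: subsetIr.
  move=> /card_gt0P[x /setDP[xM xB]]; exists x; move: (xM); rewrite inE => /andP[xT /eqP ox].
  by split=> //; apply: contra xB => bx; apply: (subsetP sub); rewrite inE xM.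
have /fin_all_exists[col hcol] v : exists x, if active v then
    [&& x \in T, own x == v & ~~ bad v x] else f v == Some x.
  case av: (active v); last by move: av; rewrite /active; case: (f v) => [t _|//]; exists t.
  by have [x [xT ox bx]] := free v; exists x; rewrite xT ox eqxx bx.
have colL v : col v \in L v.
  have := hcol v; case: ifP => [_ /and3P[xT /eqP ox _]|_ /eqP /fL //].
  by rewrite -{2}ox TL.
exists col; split=> //.
(* The smaller scale gives way. If both are active, the colour of [v] is not [bad]; if only [v] is,
   its menu base avoids the colour of [w]. If [v] is not active, [menu_base] (for active [w]) or
   [partials] leaves conflicts between distant scales, and these would make [v] active. *)
suff key v w : (s v <= s w)%N -> ~~ cf (col v) (col w).
  by move=> u v; case: (leqP (s u) (s v)) => [/key//|/ltnW/key]; rewrite cf_sym.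
move=> svw; apply/negP => cvw.
have ov := L_own (colL v); have ow := L_own (colL w).
have := hcol v; have := hcol w.
case aw: (active w); case av: (active v).
- move=> /and3P[wT _ _] /and3P[_ _ /negP]; apply; apply/exists_inP; exists (col w) => //.
  by rewrite cvw ow aw andbT /near; lia.
- move=> /and3P[wT _ _] /eqP fv.
  have := TM _ wT; rewrite ow inE => /andP[_ /forallP/(_ (col v))].
  rewrite {1}/sel ov fv eqxx cf_sym cvw /= => sv.
  move/negbT: av; rewrite /active fv => /negP; apply; apply/existsP; exists (col w).
  by rewrite wT orbT cvw ow sv.
- move=> /eqP fw /and3P[vT _ _].
  have := TM _ vT; rewrite ov inE => /andP[_ /forallP/(_ (col w))].
  by rewrite {1}/sel ow fw eqxx cvw /=; lia.
move=> /eqP fw /eqP fv.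
have sv : sel own f (col v) by rewrite /sel ov fv.
have sw : sel own f (col w) by rewrite /sel ow fw.
have := fC _ _ sv sw cvw; rewrite ov ow /near => nn.
move/negbT: av; rewrite /active fv => /negP; apply; apply/existsP; exists (col w).
by rewrite sw cvw ow /=; lia.
Qed.

End Phase2.

(** * Estimates *)

Section Estimates.

Variable R : realType.
Implicit Types (x y D eps tau : R).

Lemma exp2_le_expR (n : nat) y : n%:R <= y -> 2 ^+ n <= expR y.
Proof.
move=> ny; apply: le_trans (_ : expR n%:R <= _); last by rewrite ler_expR.
rewrite -[n%:R]mulr1 expRM_natl; apply: lerXn2r; rewrite ?nnegrE ?expR_ge0 //.
by apply: le_trans (expR_ge1Dx _); lra.
Qed.

Lemma ln_exp2_ge (n : nat) x : 2 ^+ n <= x -> n%:R / 2 <= ln x.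
Proof.
move=> nx; have x0 : 0 < x by apply: lt_le_trans nx; rewrite exprn_gt0.
rewrite -ler_expR lnK ?posrE //; apply: le_trans nx.
rewrite expRM_natl; apply: lerXn2r; rewrite ?nnegrE ?expR_ge0 //.
have := expR_ge1Dx (- 2^-1 : R); rewrite expRN => h.
have e0 := expR_gt0 (2^-1 : R); rewrite -[leRHS]invrK -[leLHS]invrK.
by rewrite lef_pV2 ?posrE ?invr_gt0 //; lra.
Qed.

Lemma ln_dexp_ge (i : nat) x : (dexp i)%:R <= x -> 2 ^+ i / 2 <= ln x.
Proof. by rewrite /dexp natrX => /ln_exp2_ge; rewrite natrX. Qed.

Lemma ln_dexp_le (i : nat) x : 0 < x -> x <= (dexp i)%:R -> ln x <= 2 ^+ i.
Proof.
move=> x0 xi; rewrite -[leRHS]expRK ler_ln ?posrE ?expR_gt0 //; apply: le_trans xi _.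
by rewrite natrX; apply: exp2_le_expR; rewrite natrX.
Qed.

Lemma leq_exp2_dexp j : (2 ^ j <= dexp j)%N.
Proof. by rewrite /dexp leq_exp2l // ltnW // ltn_expl. Qed.

Lemma card_le_load (X : finType) (A : {set X}) (w : X -> R) (d tau : R) :
  (forall z, 0 <= w z) -> \sum_(z in A) w z <= d -> 0 < tau ->
  #|A|%:R - d / tau <= #|[set z in A | w z <= tau]|%:R.
Proof.
move=> w0 sumw tau0; set B := [set z in A | _].
have cA : (#|A| = #|B| + #|A :\: B|)%N.
  rewrite -(cardsID B A) (setIidPr _) //.
  by apply/subsetP => z; rewrite inE => /andP[].
rewrite cA natrD; suff : #|A :\: B|%:R <= d / tau by lra.
rewrite ler_pdivlMr //; apply: le_trans sumw.
rewrite mulr_natl -sumr_const.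
apply: le_trans (_ : \sum_(z in A :\: B) w z <= _).
  by apply: ler_sum => z; rewrite !inE => /andP[+ zA]; rewrite zA -ltNge => /ltW.
by apply: ler_sum_subpred => // z /setDP[].
Qed.

(** Here [tau = rho * ln D] with [rho < 1], so [D * expR (- tau)] is a positive power of [D]. At
    most [D / tau] colours have a larger load, which leaves [eps / 2 * (D / ln D)] of them. *)
Lemma retention_estimate eps D (K N : R) (i c k : nat) : 0 < eps ->
  (dexp i)%:R <= D -> D <= (dexp i.+1)%:R -> (c <= i)%N ->
  16 * (1 + eps) <= eps * 2 ^+ c -> 2 ^+ (2 * c + k + 5) <= eps * (dexp (i - c))%:R ->
  (1 + eps) * (D / ln D) <= K ->
  K - D / ((1 + eps / 2) / (1 + eps) * ln D) <= N ->
  2 ^+ dexp (i - c) * expR (- (2^-1 * (N * expR (- ((1 + eps / 2) / (1 + eps) * ln D))))) <=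
  idexp R (i + k + 1).
Proof.
move=> eps0 iD Di ci hc hk hK hN.
have D0 : 0 < D by apply: lt_le_trans iD; rewrite ltr0n dexp_gt0.
set l := ln D in hK hN *; have lge : 2 ^+ i / 2 <= l := ln_dexp_ge iD.
have lle : l <= 2 ^+ i.+1 by apply: ln_dexp_le.
have p0 : 0 < 2 ^+ i :> R by rewrite exprn_gt0.
have l0 : 0 < l by apply: lt_le_trans lge; rewrite divr_gt0.
set rho := (1 + eps / 2) / (1 + eps) in hN *.
have rho0 : 0 < rho by rewrite divr_gt0 //; lra.
set j := (i - c)%N; have ij : i = (j + c)%N by rewrite /j subnK.
set M : R := (dexp j)%:R.
have M1 : 1 <= M by rewrite ler1n dexp_gt0.
have N_ge : eps / 2 * (D / l) <= N.
  apply: le_trans hN; apply: le_trans (lerB hK (lexx _)).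
  have -> : (1 + eps) * (D / l) - D / (rho * l) = (D / l) * ((1 + eps) - rho^-1).
    by field; rewrite !gt_eqF.
  have -> : (1 + eps) - rho^-1 = (1 + eps) * (eps / 2) / (1 + eps / 2).
    by rewrite /rho; field; rewrite !gt_eqF //; lra.
  rewrite mulrC; apply: ler_wpM2l; first by rewrite divr_ge0 // ltW.
  have e1 : 0 < 1 + eps / 2 by lra.
  by rewrite ler_pdivlMr //; nra.
(* Since [ln D] is at least [2 ^ i / 2], the choice of [c] makes the exponent at least
   [4 * 2 ^ (i - c)]. *)
have exp_ge : M ^+ 4 <= D * expR (- (rho * l)).
  rewrite -{1}[D](lnK _) ?posrE // -expRD -/l.
  have -> : l + - (rho * l) = (eps / 2 / (1 + eps)) * l.
    by rewrite /rho; field; rewrite gt_eqF //; lra.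
  have -> : M ^+ 4 = 2 ^+ (4 * 2 ^ j) by rewrite /M natrX -exprM mulnC.
  apply: exp2_le_expR; rewrite natrM natrX.
  apply: le_trans (_ : eps / 2 / (1 + eps) * (2 ^+ i / 2) <= _); last first.
    by rewrite ler_wpM2l // !divr_ge0 //; lra.
  rewrite ij exprD.
  have -> : eps / 2 / (1 + eps) * (2 ^+ j * 2 ^+ c / 2) = (eps * 2 ^+ c) / (1 + eps) / 4 * 2 ^+ j.
    by field; rewrite gt_eqF //; lra.
  apply: ler_wpM2r; first by rewrite exprn_ge0.
  by rewrite ler_pdivlMr // ler_pdivlMr; lra.
have l_le : l <= 2 ^+ c.+1 * M.
  apply: le_trans lle _; rewrite ij -addnS exprD mulrC ler_wpM2l ?exprn_ge0 //.
  by rewrite /M -natrX ler_nat leq_exp2_dexp.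
(* Compares exponents: [M] is that of [2 ^ dexp (i - c)], and [2 ^ (i + k + 1)] that of
   [dexp (i + k + 1)]. *)
have main : M + 2 ^+ (i + k + 1) <= 2^-1 * (N * expR (- (rho * l))).
  apply: le_trans (_ : 2^-1 * (eps / 2 / l * M ^+ 4) <= _); last first.
    apply: ler_wpM2l; first by rewrite invr_ge0.
    apply: le_trans (_ : eps / 2 / l * (D * expR (- (rho * l))) <= _).
      by apply: ler_wpM2l exp_ge; rewrite !divr_ge0 // ltW.
    have -> : eps / 2 / l * (D * expR (- (rho * l))) = eps / 2 * (D / l) * expR (- (rho * l)).
      by ring.
    by rewrite ler_wpM2r ?expR_ge0.
  have -> : 2^-1 * (eps / 2 / l * M ^+ 4) = eps * M ^+ 4 / (4 * l) by field; rewrite gt_eqF.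
  rewrite ler_pdivlMr ?mulr_gt0 //.
  have c0 : 0 < 2 ^+ c :> R by rewrite exprn_gt0.
  have k0 : 1 <= 2 ^+ k :> R by rewrite exprn_ege1 // ler1n.
  have c1 : 1 <= 2 ^+ c :> R by rewrite exprn_ege1 // ler1n.
  have jM : 2 ^+ j <= M by rewrite /M -natrX ler_nat leq_exp2_dexp.
  have sumle : M + 2 ^+ (i + k + 1) <= 4 * 2 ^+ c * 2 ^+ k * M.
    rewrite ij !exprD expr1.
    have : 2 ^+ j * 2 ^+ c * 2 ^+ k * 2 <= M * 2 ^+ c * 2 ^+ k * 2.
      by rewrite !ler_wpM2r ?exprn_ge0.
    have : 1 <= 2 ^+ c * 2 ^+ k :> R by rewrite -[leLHS]mulr1 ler_pM.
    by nra.
  apply: le_trans (_ : (4 * 2 ^+ c * 2 ^+ k * M) * (4 * (2 ^+ c.+1 * M)) <= _).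
    apply: ler_pM => //.
    - by rewrite addr_ge0 ?exprn_ge0 //; lra.
    - by rewrite mulr_ge0 // ltW.
    by rewrite ler_wpM2l.
  rewrite exprS; move: hk; rewrite !exprD expr0 mulr1 -/j -/M => hk.
  have -> : 4 * 2 ^+ c * 2 ^+ k * M * (4 * (2 * 2 ^+ c * M)) =
     2 ^+ c * 2 ^+ c * 2 ^+ k * 2 ^+ 5 * M ^+ 2 :> R by ring.
  apply: le_trans (_ : eps * M * M ^+ 2 <= _).
    by rewrite ler_wpM2r // exprn_ge0 //; lra.
  have -> : eps * M * M ^+ 2 = eps * M ^+ 3 by ring.
  by rewrite ler_pM2l // ler_weXn2l.
rewrite [X in _ * X <= _]expRN /idexp ler_pdivrMr ?expR_gt0 //.
rewrite ler_pdivlMl ?ltr0n ?dexp_gt0 // /dexp natrX -exprD.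
by apply: exp2_le_expR; rewrite natrD natrX addrC.
Qed.

End Estimates.

(** * Fixing the parameters *)

Lemma leq_double_exp2 n : (0 < n)%N -> (2 * n <= 2 ^ n)%N.
Proof. by case: n => // n _; rewrite expnS leq_mul2l /= ltn_expl. Qed.

Lemma leq_shift_exp2 C i : (3 * C + 2 <= i)%N -> (i + C <= 2 ^ (i - C))%N.
Proof.
move=> hi; apply: leq_trans (leq_double_exp2 _); lia.
Qed.

Lemma exists_exp2_ge (R : realType) (x : R) : exists n : nat, x <= 2 ^+ n.
Proof.
by exists (Num.bound x); apply/ltW/upper_nthrootP.
Qed.

Theorem scaled_colouring (R : realType) (eps : R) (A : nat) : 0 < eps ->
  exists i0 : nat, forall (V X : finType) (e : rel V) (own : X -> V) (cf : rel X)
    (L : V -> {set X}) (s : V -> nat) (D : V -> R) (s0 : nat),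
  symmetric e ->
  (forall x y z, ~~ [&& e x y, e y z & e x z]) ->
  symmetric cf ->
  (forall x y, cf x y -> e (own x) (own y)) ->
  (forall x y y', cf x y -> cf x y' -> own y = own y' -> y = y') ->
  (forall v x, x \in L v -> own x = v) ->
  (i0 <= s0)%N ->
  (forall v, (s0 <= s v < A * 2 ^ s0)%N) ->
  (forall v, (dexp (s v))%:R <= D v <= (dexp (s v).+1)%:R) ->
  (forall v, #|[set z | e v z]|%:R <= D v) ->
  (forall v, (1 + eps) * (D v / ln (D v)) <= #|L v|%:R) ->
  exists col : V -> X, (forall v, col v \in L v) /\ forall u v, ~~ cf (col u) (col v).
Proof.
move=> eps0.
have [c hc] := exists_exp2_ge (16 * (1 + eps) / eps).
have [B hB] := exists_exp2_ge (1 + eps).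
have [B' hB'] := exists_exp2_ge (eps^-1).
(* [C] exceeds every shift of scales that occurs. From [3 * C + 2] on, [i + C] is at most
   [2 ^ (i - C)], so [dexp (i - j)] absorbs [2 ^ (i + n)]. *)
pose C := (100 * c + 500 + A + B + B')%N.
exists (3 * C + 2)%N => V X e own cf L s D s0 e_sym e_tri cf_sym cf_e cf_match L_own hs0 hs hD degD LD.
have s_ge v : (s0 <= s v)%N by have /andP[] := hs v.
have large i : (s0 <= i)%N -> (i + C <= 2 ^ (i - C))%N.
  by move=> hi; apply: leq_shift_exp2; apply: leq_trans hs0 hi.
have large_dexp i n j : (s0 <= i)%N -> (n <= C)%N -> (j <= C)%N -> (2 ^ (i + n) <= dexp (i - j))%N.
  move=> hi hn hj; rewrite /dexp leq_exp2l //; apply: leq_trans (_ : i + C <= _)%N.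
    by rewrite leq_add2l.
  by apply: leq_trans (large i hi) _; rewrite leq_exp2l //; lia.
(* Lists are cut to polynomial size for the union bounds over colours; [1 + eps <= ln (D v)] keeps
   them long enough. *)
have trunc v : exists L' : {set X}, [/\ L' \subset L v, (#|L'| <= dexp (s v).+1)%N &
    (1 + eps) * (D v / ln (D v)) <= #|L'|%:R].
  case: (leqP #|L v| (dexp (s v).+1)) => [le1|/ltnW /subset_of_card[L' L'L cL']]; first by exists (L v).
  exists L'; split; rewrite ?cL' //.
  have /andP[D1 D2] := hD v; apply: le_trans D2.
  have l1 : 1 + eps <= ln (D v).
    apply: le_trans (ln_dexp_ge D1); rewrite ler_pdivlMr //.
    apply: le_trans (_ : 2 ^+ B.+1 <= _); first by rewrite exprSr ler_wpM2r.
    by rewrite ler_weXn2l ?ler1n //; have := s_ge v; rewrite /C in hs0 *; lia.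
  have D0 : 0 <= D v by apply: le_trans D1.
  rewrite mulrCA ler_piMr // ler_pdivrMr ?mul1r //; lra.
have /fin_all_exists[L' hL'] := trunc.
have L'_own v x : x \in L' v -> own x = v.
  by have [sub _ _] := hL' v; move=> /(subsetP sub)/L_own.
have deg_le v : (#|[set z | e v z]| <= dexp (s v).+1)%N.
  by rewrite -(ler_nat R); apply: le_trans (degD v) _; have /andP[] := hD v.
have L'_le v : (#|L' v| <= dexp (s v).+1)%N by have [_ cL _] := hL' v; apply: cL.
pose a := (c + 5)%N; pose b := (3 * c + 15)%N; pose h := (7 * c + 40)%N; pose k := (9 * c + 51)%N.
have s0_ge : (20 * c + 100 <= s0)%N by move: hs0; rewrite /C; lia.
have hc' : 16 * (1 + eps) <= eps * 2 ^+ c by rewrite [leRHS]mulrC -ler_pdivrMr.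
have retention v : exists tau, forall f, f \in partials own cf L' (near s b) ->
    2 ^+ dexp (s v - c) *
    expR (- (2^-1 * (#|[set x in L' v | load e own cf L' (near s b) R f v x <= tau]|%:R *
                      expR (- tau)))) <= idexp R (s v + k + 1).
  exists ((1 + eps / 2) / (1 + eps) * ln (D v)) => f fP.
  have /andP[D1 D2] := hD v; have [_ _ hK] := hL' v.
  have sv := s_ge v.
  apply: (retention_estimate eps0 D1 D2 _ hc' _ hK); first lia.
    apply: le_trans (_ : eps * (2 ^+ B' * 2 ^+ (2 * c + k + 5)) <= _).
      by rewrite mulrA ler_peMl ?exprn_ge0 // mulrC -ler_pdivrMr // div1r.
    rewrite ler_pM2l // -exprD -natrX ler_nat.
    apply: leq_trans (_ : 2 ^ (s v + (B' + (2 * c + k + 5))) <= _)%N.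
      by rewrite leq_exp2l // leq_addl.
    by apply: large_dexp => //; rewrite /C /k; lia.
  apply: card_le_load.
  - by move=> x; apply: load_ge0.
  - apply: le_trans (sum_load e (near s b) cf_sym cf_match L'_own R f v) _.
    apply: le_trans (degD v); rewrite ler_nat; apply: subset_leq_card.
    by apply/subsetP => z; rewrite !inE => /andP[].
  have l0 : 0 < ln (D v).
    by apply: lt_le_trans (ln_dexp_ge D1); rewrite divr_gt0 ?exprn_gt0.
  by rewrite mulr_gt0 // divr_gt0 //; lra.
have [f [fP f1 f2 f3]] := exists_partial e_sym e_tri cf_sym cf_e cf_match L'_own deg_le L'_le
  (erefl a) (erefl b) (erefl h) (erefl k) s0_ge s_ge retention.
(* [S] bounds all scales and is linear in [2 ^ s0]. So [m], linear in [S], lies below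
   [dexp (i - a - c - 5)] at every scale [i] in use. *)
pose S := (A * 2 ^ s0)%N; pose q := (2 ^ h)%N; pose m := (4 * q * q * (S + 1))%N.
have s_lt v : (s v < S)%N by have /andP[] := hs v.
have q0 : (0 < q)%N by rewrite expn_gt0.
have m_le i : (s0 <= i)%N -> (m <= dexp (i - a - c - 5))%N.
  move=> hi; apply: (@leq_trans (2 ^ (i + (3 + 2 * h + A)))); last first.
    rewrite (_ : i - a - c - 5 = i - (2 * c + 10))%N; last by rewrite /a; lia.
    by apply: large_dexp => //; rewrite /C /h; lia.
  have A1 : (S + 1 <= 2 ^ (A + 1) * 2 ^ i)%N.
    have : (A < 2 ^ A)%N by apply: ltn_expl.
    have : (2 ^ s0 <= 2 ^ i)%N by rewrite leq_exp2l.
    have : (0 < 2 ^ i)%N by rewrite expn_gt0.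
    rewrite /S expnD expn1; move: (2 ^ A)%N (2 ^ s0)%N (2 ^ i)%N => x y z; nia.
  have -> : (2 ^ (i + (3 + 2 * h + A)) = 4 * q * q * (2 ^ (A + 1) * 2 ^ i))%N.
    by rewrite /q (_ : 4 = 2 ^ 2)%N // -!expnD; congr (2 ^ _)%N; lia.
  by rewrite leq_mul2l A1 orbT.
have [|||col [colL colc]] := exists_colouring R e_sym e_tri cf_sym cf_e cf_match L'_own deg_le L'_le
  (erefl a) (erefl b) (erefl h) (erefl k) s0_ge s_ge s_lt (m := m) _ _ _ fP f1 f2 f3.
- move=> v; have sv := s_ge v; apply: (@mul_dexp _ _ (s v - a - c - 5) (s v - a - c - 5)).
  + exact: m_le.
  + rewrite (_ : s v - a - c - 5 = s v - (2 * c + 10))%N; last by rewrite /a; lia.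
    by rewrite -addnA; apply: large_dexp => //; rewrite /C /k; lia.
  + by rewrite /a; lia.
  by rewrite /a; lia.
- move=> v; have sv := s_ge v.
  have qS : (q * S <= m)%N by rewrite /m; nia.
  rewrite [leqRHS](_ : _ = dexp (s v - c - 1).+1); last by congr dexp; lia.
  rewrite dexpS; apply: (@leq_trans ((m + q * S) * dexp (s v - c - 1))%N).
    by rewrite mulnDl leq_add2l leq_pmulr ?dexp_gt0.
  rewrite leq_mul2r; apply/orP; right; apply: leq_trans (leq_add (leqnn m) qS) _.
  by apply: add_dexp (m_le _ sv) (m_le _ sv) _ _; rewrite /a; lia.
- by rewrite -/q /m; nia.
exists col; split=> // v; by have [sub _ _] := hL' v; apply: (subsetP sub).
Qed.

Lemma exists_scale (R : realType) (x : R) : 2 <= x ->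
  exists i : nat, (dexp i)%:R <= x < (dexp i.+1)%:R.
Proof.
move=> x2; have ex : exists n : nat, x < (dexp n)%:R.
  have [n xn] := exists_exp2_ge x; exists n; apply: le_lt_trans xn _.
  by rewrite -natrX ltr_nat /dexp ltn_exp2l // ltn_expl.
case: (ex_minnP ex) => -[|i] xi mini; first by rewrite ltNge x2 in xi.
by exists i; rewrite xi andbT leNgt; apply/negP => /mini; rewrite ltnn.
Qed.

(** * From covers to conflict relations *)

Lemma colourable_of_transversal (G : sgraph) (H : graph_cover G)
    (own : cover_graph H -> G) (col : G -> cover_graph H) :
  (forall x, x \in cover_list H (own x)) ->
  (forall v, own (col v) = v) ->
  (forall u v, ~~ (edge (col u) (col v) && (own (col u) != own (col v)))) ->
  colourable H.
Proof.
move=> ownP ocol nocf; exists [set col v | v : G]; split; last first.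
  by rewrite card_imset // => u v uv; rewrite -(ocol u) uv ocol.
move=> _ _ /imsetP[u _ ->] /imsetP[v _ ->]; apply/negP => euv.
have := nocf u v; rewrite euv !ocol /= negbK => /eqP uv.
by rewrite uv edge_irrefl in euv.
Qed.

Theorem theorem8 (R : realType) (eps : R) (heps : 0 < eps) :
  exists Delta0 : nat, forall Delta : nat, (Delta0 <= Delta)%N ->
    let delta : R := (192 * ln (Delta%:R : R)) `^ (2 / eps) in
    forall (G : sgraph) (H : graph_cover G),
      triangle_free G ->
      max_degree G = Delta ->
      (forall u : G,
        (1 + eps) * max_ratio (deg u) delta <= #|cover_list H u|%:R) ->
      colourable H.
Proof.
have [A0 A0P] : exists n : nat, eps <= n%:R.
  by exists (Num.bound eps); apply/ltW/archi_boundP/ltW.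
have [i0 main] := scaled_colouring (2 * A0 + 1) heps.
(* Chosen so that [192 * ln Delta >= Y] amounts to [delta >= dexp i0], which puts the smallest scale
   at [i0] or above. *)
pose Y : R := (dexp i0)%:R `^ (eps / 2).
have Y0 : 0 <= Y by apply: powR_ge0.
pose Delta0 := Num.bound (expR Y).
exists Delta0 => Delta hDelta delta G H tri maxd hL.
have lnD : Y <= ln (Delta%:R : R).
  have le1 : expR Y <= Delta%:R.
    apply: le_trans (ltW (archi_boundP (expR_ge0 Y))) _; by rewrite ler_nat.
  by rewrite -ler_expR lnK // posrE (lt_le_trans _ le1) ?expR_gt0.
pose x : R := 192 * ln (Delta%:R : R).
have deltaE : delta = x `^ (2 / eps) by [].
have xY : Y <= x by rewrite /x; lra.
have x0 : 0 <= x by lra.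
have e2 : 0 < 2 / eps by rewrite divr_gt0.
have delta_ge : (dexp i0)%:R <= delta.
  have -> : (dexp i0)%:R = Y `^ (2 / eps) :> R.
    rewrite /Y -powRrM (_ : eps / 2 * (2 / eps) = 1) ?powRr1 ?ler0n //.
    by field; rewrite gt_eqF.
  by rewrite deltaE ge0_ler_powR ?nnegrE // ltW.
have delta2 : 2 <= delta.
  by apply: le_trans delta_ge; rewrite (ler_nat R 2) dexp_gt1.
have [s0 /andP[s0d ds0]] := exists_scale delta2.
pose D (v : G) : R := Num.max (deg v)%:R delta.
have Dd v : delta <= D v by rewrite le_max lexx orbT.
have /fin_all_exists[s hs] (v : G) := exists_scale (le_trans delta2 (Dd v)).
have ownex (y : cover_graph H) : exists u, y \in cover_list H u.
  have : y \in \bigcup_(u : G) cover_list H u by rewrite cover_full inE.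
  by move=> /bigcupP[u _ yu]; exists u.
have [own ownP] := fin_all_exists ownex.
have own_eq u y : y \in cover_list H u -> own y = u.
  move=> yu; apply/eqP/negP => /negP nu.
  by have := disjointFr (cover_disjoint H nu) (ownP y); rewrite yu.
(* Edges inside a list are left out, as a transversal takes one colour per list. *)
pose cf (y z : cover_graph H) := edge y z && (own y != own z).
have cf_between y z : cf y z -> [set y; z] \in edges_between (cover_list H (own y)) (cover_list H (own z)).
  by move=> /andP[yz _]; apply/imset2P; exists y z => //; rewrite inE ownP.
have cf_edge y z : cf y z -> edge (own y) (own z).
  move=> cyz; have [|yz|//] := @cover_edge G H (own y) (own z).
    by apply/set0Pn; exists [set y; z]; apply: cf_between.
  by move: cyz; rewrite /cf yz eqxx andbF.
have [|||||||||||col [colL colc]] := main G (cover_graph H) (@edge G) own cf (fun v => cover_list H v) s D s0.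
- exact: edge_sym.
- by move=> u v w; apply: tri.
- by move=> y z; rewrite /cf edge_sym eq_sym.
- exact: cf_edge.
- move=> y z z' cyz cyz' zz'; apply/eqP/negP => /negP nz.
  have := @cover_matching G H _ _ (cf_edge _ _ cyz) [set y; z] [set y; z'].
  rewrite cf_between // zz' cf_between // => /(_ isT isT).
  have yz' : z' != y.
    by apply/eqP => zy; move: cyz'; rewrite zy /cf eqxx andbF.
  have ne : [set y; z] != [set y; z'].
    apply/eqP => /setP/(_ z'); rewrite !inE eqxx orbT (negbTE yz') /= => /eqP zz.
    by rewrite zz eqxx in nz.
  by move=> /(_ ne) /disjointFr/(_ (set21 y z)); rewrite set21.
- by move=> v y; apply: own_eq.
- have : (dexp i0)%:R < (dexp s0.+1)%:R :> R by apply: le_lt_trans ds0.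
  rewrite ltr_nat => lt1; rewrite -ltnS ltnNge; apply/negP => le1.
  by move: lt1; rewrite ltnNge leq_dexp.
- move=> v; have /andP[sD Ds] := hs v; apply/andP; split.
    have : (dexp s0)%:R < (dexp (s v).+1)%:R :> R by apply: le_lt_trans (le_trans s0d (Dd v)) Ds.
    rewrite ltr_nat => lt1; rewrite -ltnS ltnNge; apply/negP => le1.
    by move: lt1; rewrite ltnNge leq_dexp.
  have s0lt : (s0 < 2 ^ s0)%N by apply: ltn_expl.
  have [Dle|Dgt] := lerP (D v) delta.
    have : (dexp (s v))%:R < (dexp s0.+1)%:R :> R by apply: le_lt_trans (le_trans sD Dle) ds0.
    rewrite ltr_nat => lt1; have : (s v < s0.+1)%N.
      by rewrite ltnNge; apply/negP => le1; move: lt1; rewrite ltnNge leq_dexp.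
    move=> sv; apply: (@leq_trans (2 ^ s0)); first exact: leq_trans sv _.
    by rewrite leq_pmull // addn1.
  (* Here the form of [delta] enters: [2 ^ s v <= 192 * ln Delta], whose power [2 / eps] is
     [delta < dexp s0.+1]. Taking logarithms gives [s v <= 2 * eps * 2 ^ s0]. *)
  have DDelta : (dexp (s v))%:R <= Delta%:R :> R.
    apply: le_trans sD _; move: Dgt; rewrite /D lt_max ltxx orbF => Dgt.
    by rewrite max_l ?(ltW Dgt) // ler_nat -maxd /max_degree leq_bigmax.
  have l1 := ln_dexp_ge DDelta.
  have p1 : 0 < 2 ^+ s v :> R by rewrite exprn_gt0.
  have /ln_exp2_ge l2 : 2 ^+ s v <= x by rewrite /x; lra.
  have l3 : ln delta <= 2 ^+ s0.+1.
    by apply: ln_dexp_le (ltW ds0); apply: lt_le_trans delta2.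
  rewrite deltaE ln_powR in l3.
  have l4 : ln x <= eps * 2 ^+ s0.
    rewrite -(ler_pM2l e2); apply: le_trans l3 _; rewrite exprS mulrA.
    by rewrite (_ : 2 / eps * eps = 2) //; field; rewrite gt_eqF.
  have : (s v)%:R <= ((2 * A0) * 2 ^ s0)%:R :> R.
    rewrite natrM natrX natrM; have p2 : 0 < 2 ^+ s0 :> R by rewrite exprn_gt0.
    have := ler_wpM2r (ltW p2) A0P; lra.
  rewrite ler_nat => sv; apply: leq_ltn_trans sv _.
  by rewrite ltn_pmul2r ?expn_gt0 // addn1.
- by move=> v; have /andP[sD /ltW Ds] := hs v; rewrite sD Ds.
- by move=> v; rewrite /D le_max /deg /neighbours lexx.
(* [D v] is [deg v] or [delta], so its ratio is one of the two; for [deg v <= 1] it is the second,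
   as [delta >= 2]. *)
- move=> v; apply: le_trans (hL v); rewrite ler_pM2l; last by lra.
  rewrite /max_ratio; case: leqP => d1.
    by rewrite /D max_r // (le_trans _ delta2) // (ler_nat R _ 2) (leq_trans d1).
  by rewrite /D; case: (leP (deg v)%:R delta) => _; rewrite le_max lexx ?orbT.
apply: (@colourable_of_transversal G H own col) => // v.
exact: own_eq (colL v).
Qed.
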